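(* Let $X$ be a separable (real or complex) Banach space which is not quasireflexive. Then for each ordinal $\alpha<\omega_1$ there is an (unbounded) absolutely convex norm-open set $U$ in $X^*$ such that $U^{(\widetilde{\beta})}\subsetneqq U^{(\widetilde{\beta+1})}$ for every ordinal $\beta\le\alpha$ and $U^{(\widetilde{\alpha+1})}=X^*$.
   Context: A Banach space $X$ is quasireflexive if the quotient $X^{**}/X$ (with $X$ canonically embedded in $X^{**}$) has finite dimension. $\omega_1$ is the first uncountable ordinal. For a norm-open set $U\subset X^*$, a subset $B\subset U$ is $U$-bounded if it is bounded and has positive distance to $X^*\setminus U$ (void condition if $U=X^*$). The envelope of $U$ is $\tilde U:=\bigcup\{\overline{B}^{w^*}: B \text{ is } U\text{-bounded}\}$, where $\overline{B}^{w^*}$ is the weak* closure in $X^*$; $\tilde U$ is again norm-open. Iterated envelopes are defined by $U^{(\widetilde{0})}=U$, $U^{(\widetilde{\beta+1})}=\widetilde{U^{(\widetilde{\beta})}}$, and $U^{(\widetilde{\alpha})}=\bigcup_{\beta<\alpha}U^{(\widetilde{\beta})}$ for limit ordinals $\alpha$. *)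

(* Defs.v *)
From HB Require Import structures.
From mathcomp Require Import all_boot all_order all_algebra.
From mathcomp Require Import complex.
From mathcomp Require Import all_classical all_reals all_analysis.

Set Implicit Arguments.
Unset Strict Implicit.
Unset Printing Implicit Defensive.

Import Order.TTheory GRing.Theory Num.Theory.
Import numFieldNormedType.Exports.

Local Open Scope classical_set_scope.
Local Open Scope ring_scope.

(* [scalars R false] is the real field R, [scalars R true] the complex field
   R[i]; "real or complex" becomes a quantification over the boolean. *)
Definition scalars (R : realType) (cplx : bool) : numFieldType :=
  if cplx then (R[i] : numFieldType) else (R : numFieldType).

(* The norms of MathComp-Analysis are K-valued, hence their suprema are taken
   in R and transported back to K = [scalars R cplx]. *)
Definition modulus (R : realType) (cplx : bool) : scalars R cplx -> R :=
  match cplx with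
  | true => fun z => complex.Re (`|z| : R[i])
  | false => fun z => `|z|
  end.

Definition of_real (R : realType) (cplx : bool) : R -> scalars R cplx :=
  match cplx with
  | true => fun r => real_complex R r
  | false => fun r => r
  end.

Arguments of_real {R} cplx r.

Section scalars_theory.
Variables (R : realType) (cplx : bool).
Local Notation K := (scalars R cplx).
Local Notation of_real := (@of_real R cplx).

Lemma of_real_modulus (z : K) : of_real (modulus z) = `|z|.
Proof. by case: cplx z => //= z; rewrite RRe_real// normr_real. Qed.

Lemma modulus_ge0 (z : K) : 0 <= modulus z.
Proof.
case: cplx z => //= z; have := normr_ge0 (z : R[i]).
by rewrite lecE /= => /andP[].
Qed.

Lemma ler_of_real : {mono of_real : r s / r <= s}.
Proof. by case: cplx => //= r s; rewrite lecR. Qed.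

Lemma of_real0 : of_real 0 = 0.
Proof. by case: cplx. Qed.

Lemma ger0_of_realE (M : K) : 0 <= M -> M = of_real (modulus M).
Proof. by move=> M0; rewrite of_real_modulus ger0_norm. Qed.

End scalars_theory.

Section dual.
Variables (R : realType) (cplx : bool).
Local Notation K := (scalars R cplx).
Variable X : normedModType K.

Definition dual_pred : {pred X -> K^o} :=
  mem [set f : X -> K^o | linear f /\ continuous f].

Record dual := Dual {
  dual_val :> X -> K^o ;
  dualP : dual_val \in dual_pred }.

HB.instance Definition _ := [isSub for dual_val].
HB.instance Definition _ := [Choice of dual by <:].

Lemma dual_submod_closed : submod_closed dual_pred.
Proof.
split; first rewrite inE.
  by split; [move=> a u v /=; rewrite scaler0 addr0|exact: cst_continuous].
move=> a f g; rewrite !inE => -[lf cf] [lg cg]; split.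
  move=> k u v /=; rewrite !fctE lf lg !scalerDr !scalerA (mulrC a k) -!addrA.
  by congr (_ + _); rewrite addrCA.
by move=> x; apply: cvgD; [apply: cvgZr; exact: cf|exact: cg].
Qed.

HB.instance Definition _ :=
  GRing.isSubmodClosed.Build _ _ dual_pred dual_submod_closed.
HB.instance Definition _ := [SubChoice_isSubLmodule of dual by <:].

Lemma dual_linear (f : dual) : linear f.
Proof. by have := dualP f; rewrite inE => -[]. Qed.

Lemma dual_continuous (f : dual) : continuous f.
Proof. by have := dualP f; rewrite inE => -[]. Qed.

Lemma dual_eqP (f g : dual) : f =1 g -> f = g.
Proof. by move=> fg; apply/val_inj/funext. Qed.

Lemma dualDE (f g : dual) x : (f + g) x = f x + g x.
Proof. by []. Qed.

Lemma dualZE (a : K) (f : dual) x : (a *: f) x = a *: f x.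
Proof. by []. Qed.

Lemma dual0E x : (0 : dual) x = 0.
Proof. by []. Qed.

(* ||f|| = sup { |f x| : ||x|| <= 1 } *)
Definition dual_norm (f : dual) : K :=
  of_real cplx (sup [set modulus (f x) | x in [set x : X | `|x| <= 1]]).

Lemma dual_bounded (f : dual) : exists2 M : K, 0 <= M &
  forall x, `|f x| <= M * `|x|.
Proof.
pose g : {linear X -> K^o} := HB.pack (dual_val f)
  (GRing.isLinear.Build _ _ _ _ _ (dual_linear f)).
have /linear_bounded_continuous/linear_boundedP : continuous g.
  exact: dual_continuous.
by move=> /pinfty_ex_gt0[M M0 Mg]; exists M => //; exact: ltW.
Qed.

Lemma dual_has_sup (f : dual) :
  has_sup [set modulus (f x) | x in [set x : X | `|x| <= 1]].
Proof.
split; first by exists (modulus (f 0)), 0 => //=; rewrite normr0.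
have [M M0 Mf] := dual_bounded f; exists (modulus M) => _ [x /= x1 <-].
rewrite -(ler_of_real cplx) of_real_modulus -ger0_of_realE//.
by rewrite (le_trans (Mf x))// ler_piMr.
Qed.

Lemma dual_norm_ge0 (f : dual) : 0 <= dual_norm f.
Proof.
rewrite -(of_real0 R cplx) ler_of_real.
apply: (le_trans (modulus_ge0 (f 0))).
apply: sup_upper_bound; first exact: dual_has_sup.
by exists 0 => //=; rewrite normr0.
Qed.

Lemma dual_norm_ub (f : dual) x : `|f x| <= dual_norm f * `|x|.
Proof.
have f0 : f 0 = 0.
  apply: (addrI (f 0)); rewrite addr0.
  by have := dual_linear f 1 0 0; rewrite scaler0 addr0 scale1r.
have fZ a u : f (a *: u) = a *: f u.
  by have := dual_linear f a u 0; rewrite !addr0 f0 addr0.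
have f1 y : `|y| <= 1 -> `|f y| <= dual_norm f.
  move=> y1; rewrite -of_real_modulus ler_of_real.
  by apply: sup_upper_bound; [exact: dual_has_sup|exists y].
have [->|x0] := eqVneq x 0; first by rewrite f0 !normr0 mulr0.
have nx0 : 0 < `|x| by rewrite normr_gt0.
rewrite -ler_pdivrMr// mulrC -[X in X * _]ger0_norm ?invr_ge0//.
rewrite -[leLHS]normrM -[X in `|X|]fZ f1// normrZ ger0_norm ?invr_ge0//.
by rewrite mulVf// gt_eqF.
Qed.

Lemma dual_norm_le (f : dual) (M : K) : 0 <= M ->
  (forall x, `|x| <= 1 -> `|f x| <= M) -> dual_norm f <= M.
Proof.
move=> M0 fM; rewrite (ger0_of_realE M0) ler_of_real.
apply: ge_sup; first by have [] := dual_has_sup f.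
move=> _ [x /= x1 <-].
by rewrite -(ler_of_real cplx) of_real_modulus -ger0_of_realE// fM.
Qed.

Lemma dual_norm_ub1 (f : dual) x : `|x| <= 1 -> `|f x| <= dual_norm f.
Proof.
by move=> x1; rewrite (le_trans (dual_norm_ub f x))// ler_piMr// dual_norm_ge0.
Qed.

Lemma dual_ler_normD f g : dual_norm (f + g) <= dual_norm f + dual_norm g.
Proof.
apply: dual_norm_le => [|x x1]; first by rewrite addr_ge0// dual_norm_ge0.
by rewrite dualDE (le_trans (ler_normD _ _))// lerD// dual_norm_ub1.
Qed.

Lemma dual_norm0_eq0 f : dual_norm f = 0 -> f = 0.
Proof.
move=> f0; apply: dual_eqP => x; apply/eqP; rewrite -normr_le0.
by rewrite (le_trans (dual_norm_ub f x))// f0 mul0r.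
Qed.

Lemma dual_normZ a f : dual_norm (a *: f) = `|a| * dual_norm f.
Proof.
have le b g : dual_norm (b *: g) <= `|b| * dual_norm g.
  apply: dual_norm_le => [|x x1]; first by rewrite mulr_ge0// dual_norm_ge0.
  by rewrite dualZE normrZ ler_wpM2l// dual_norm_ub1.
apply/le_anti; rewrite le/=.
have [->|a0] := eqVneq a 0; first by rewrite normr0 mul0r dual_norm_ge0.
rewrite -ler_pdivlMl ?normr_gt0// -normfV.
by rewrite -[in leLHS](scalerK a0 f) le.
Qed.

HB.instance Definition _ :=
  Lmodule_isNormed.Build K dual dual_ler_normD dual_normZ dual_norm0_eq0.

Lemma dual_normE (f : dual) : `|f| = dual_norm f.
Proof. by []. Qed.

(* The weak* topology: the coarsest one making every evaluation
   [f |-> f x] continuous. *)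
Definition weak_star :=
  initial_topology (dual_val : dual -> {ptws X -> K^o}).

HB.instance Definition _ := Topological.on weak_star.

Definition weak_star_closure (B : set dual) : set dual :=
  @closure weak_star B.

(* Positive distance to the complement; void when U is the whole space. *)
Definition Ubounded (U B : set dual) :=
  [/\ B `<=` U, bounded_set B &
    exists2 d : K, 0 < d & forall f g, B f -> ~ U g -> d <= `|f - g|].

Definition envelope (U : set dual) : set dual :=
  \bigcup_(B in Ubounded U) weak_star_closure B.

End dual.

Section quasireflexive.
Variables (R : realType) (cplx : bool).
Local Notation K := (scalars R cplx).

Section canonical_embedding.
Variable X : normedModType K.

Lemma canonical_subproof (x : X) :
  (fun f : dual X => f x) \in @dual_pred R cplx (dual X).
Proof.
rewrite inE; split=> [//|].
have lin : linear (fun f : dual X => f x : K^o) by [].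
pose g : {linear dual X -> K^o} := HB.pack (fun f : dual X => f x : K^o)
  (GRing.isLinear.Build _ _ _ _ _ lin).
apply: (@bounded_linear_continuous _ _ _ g); apply/bounded_funP => r.
exists (r * `|x|) => f fr /=.
by rewrite (le_trans (dual_norm_ub f x))// ler_wpM2r.
Qed.

Definition canonical (x : X) : dual (dual X) := Dual (canonical_subproof x).

End canonical_embedding.

(* The quotient V/W has finite dimension: the classes of finitely many vectors
   span it. *)
Definition finite_dim_quotient (V : lmodType K) (W : set V) :=
  exists (n : nat) (v : 'I_n -> V), forall u : V, exists c : 'I_n -> K,
    W (u - \sum_(i < n) c i *: v i).

Definition quasireflexive (X : normedModType K) :=
  @finite_dim_quotient (dual (dual X)) (range (@canonical X)).

End quasireflexive.

Definition separable (T : topologicalType) :=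
  exists2 S : set T, countable S & dense S.

Definition absolutely_convex (K : numFieldType) (V : lmodType K) (A : set V) :=
  forall (a b : K) (x y : V), `|a| + `|b| <= 1 -> A x -> A y ->
    A (a *: x + b *: y).

(* Ordinals are the elements t of a well-ordered type T, t standing for the
   order type of its initial segment [set s | s < t]; every ordinal arises in
   this way. *)
Section iterated_envelope.
Context {d : Order.disp_t} {T : orderType d}.
Hypothesis wfT : well_founded (fun s t : T => (s < t)%O).

Definition is_zero (t : T) := forall s : T, (t <= s)%O.

Definition is_succ (s t : T) :=
  (s < t)%O /\ forall r : T, (r < t)%O -> (r <= s)%O.

Definition is_limit (t : T) := ~ is_zero t /\ ~ exists s, is_succ s t.

Variables (R : realType) (cplx : bool).
Local Notation K := (scalars R cplx).
Variable X : normedModType K.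
Implicit Types U : set (dual X).

(* The three disjuncts are mutually exclusive; see the equations below. *)
Definition iter_envelope_step U (t : T)
    (V : forall s : T, (s < t)%O -> set (dual X)) : set (dual X) :=
  [set f | [\/ is_zero t /\ U f,
    exists s (st : (s < t)%O), is_succ s t /\ envelope (V s st) f |
    is_limit t /\ exists s (st : (s < t)%O), V s st f]].

Definition iter_envelope U : T -> set (dual X) :=
  Fix wfT (fun=> set (dual X)) (iter_envelope_step U).

Lemma iter_envelopeE U t :
  iter_envelope U t =
    iter_envelope_step U (fun s (_ : (s < t)%O) => iter_envelope U s).
Proof.
rewrite /iter_envelope Fix_eq// => {}t V W VW.
congr iter_envelope_step.
by apply/functional_extensionality_dep => s; apply/funext.
Qed.

Lemma is_succ_nzero s t : is_succ s t -> ~ is_zero t.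
Proof. by move=> [st _] /(_ s); rewrite leNgt st. Qed.

Lemma is_succ_inj s s' t : is_succ s t -> is_succ s' t -> s = s'.
Proof.
by move=> [st sm] [s't s'm]; apply/le_anti; rewrite sm// s'm.
Qed.

Lemma iter_envelope0 U t : is_zero t -> iter_envelope U t = U.
Proof.
move=> t0; rewrite iter_envelopeE; apply/seteqP; split=> f /=.
  by case=> [[]|[s [_ [/is_succ_nzero]]]|[[]]].
by move=> Uf; apply: Or31.
Qed.

Lemma iter_envelopeS U s t : is_succ s t ->
  iter_envelope U t = envelope (iter_envelope U s).
Proof.
move=> st; rewrite iter_envelopeE; apply/seteqP; split=> f /=.
  case=> [[/(is_succ_nzero st)]//|[s' [_ [/(is_succ_inj st) <-]]]//|].
  by move=> [[_]] []; exists s.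
by move=> ef; apply: Or32; exists s, st.1.
Qed.

Lemma iter_envelope_lim U t : is_limit t ->
  iter_envelope U t = \bigcup_(s in [set s | (s < t)%O]) iter_envelope U s.
Proof.
move=> tl; rewrite iter_envelopeE; apply/seteqP; split=> f /=.
  case=> [[]|[s [_ [st _]]]|[_ [s [st Vf]]]]; first by case: tl.
    by case: tl => _ []; exists s.
  by exists s.
by move=> [s st Vf]; apply: Or33; split=> //; exists s, st.
Qed.

End iterated_envelope.

(* Main.v *)
From HB Require Import structures.
Require Import Defs.
From mathcomp Require Import all_boot all_order all_algebra.
From mathcomp Require Import complex ring lra.
From mathcomp Require Import all_classical all_reals all_analysis.

Set Implicit Arguments.
Unset Strict Implicit.
Unset Printing Implicit Defensive.

Import Order.TTheory GRing.Theory Num.Theory.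
Import numFieldNormedType.Exports.
Local Open Scope classical_set_scope.
Local Open Scope ring_scope.

(* Since X**/X is infinite dimensional, one can choose G_0, G_1, ... in X**
   and bounded functionals on X**/X biorthogonal to them. Helly's theorem then
   gives bounded sequences (y_{s,m})_m in X that agree in the limit with G_s on
   a countable set of functionals, and bounded weak* null sequences (e_{s,n})_n
   in X* with G_t(e_{s,n}) = 1 if s = t and 0 otherwise. As X is separable, that
   countable set may contain a weak* dense sequence of the unit ball of X*.

   The indices s are arranged in a well-founded tree whose root has rank alpha;
   the n-th child of s is attached to the point y_{s,n+1} - y_{s,n}, and x_t
   denotes the point attached to t. Let A be the space of the functionals a
   with lim_m a(y_{t,m}) = a(x_t) for every vertex t, and U = A + (open unit
   ball). Each envelope destroys these constraints at exactly the vertices of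
   the lowest remaining rank:
   - as |y_{t,m}| <= 2^-t, the constraints at the children of s force
     a(y_{s,m}) to converge at a rate depending only on |a|, so that the
     constraint at s passes to bounded weak* limits;
   - the constraint at s is lost once those at its children are, because it
     can be repaired by adding a multiple of e_{s,n}, at the cost of violating
     the constraint at the n-th child of s.
   Hence the constraint at the root, of rank alpha, survives in the iterate
   number alpha and disappears in the next one. *)
(** * The Hahn-Banach theorem over the real or complex scalars *)

Lemma normc_lt (R : realType) (a b r : R) :
  `|a| < r / 2 -> `|b| < r / 2 -> `|(a +i* b)%C| < r%:C%C.
Proof.
move=> ar br; rewrite (_ : (a +i* b)%C = a%:C%C + 'i%C * b%:C%C); last first.
  by apply/eqP; rewrite eq_complex /=; apply/andP; split; apply/eqP; ring.
apply: le_lt_trans (ler_normD _ _) _; rewrite normrM.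
have -> : `|'i%C : R[i]| = 1 by rewrite normc_def /= expr0n /= add0r expr1n sqrtr1.
rewrite mul1r !normc_def /= !expr0n /= !addr0 !sqrtr_sqr -rmorphD ltcR.
by rewrite [r]splitr ltrD.
Qed.

Section scalars_extra.
Variables (R : realType) (cplx : bool).
Local Notation K := (scalars R cplx).
Local Notation of_real := (@of_real R cplx).

Lemma of_realD r s : of_real (r + s) = of_real r + of_real s.
Proof. by case: cplx => //=; rewrite rmorphD. Qed.

Lemma of_realM r s : of_real (r * s) = of_real r * of_real s.
Proof. by case: cplx => //=; rewrite rmorphM. Qed.

Lemma of_realN r : of_real (- r) = - of_real r.
Proof. by case: cplx => //=; rewrite rmorphN. Qed.

Lemma of_real1 : of_real 1 = 1.
Proof. by case: cplx. Qed.

Lemma of_real_inj : injective of_real.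
Proof. by move=> r s /eqP; rewrite eq_le !ler_of_real -eq_le => /eqP. Qed.

Lemma modulusM (a b : K) : modulus (a * b) = modulus a * modulus b.
Proof. by apply: of_real_inj; rewrite of_realM !of_real_modulus normrM. Qed.

Lemma modulus_of_real r : 0 <= r -> modulus (of_real r) = r.
Proof.
move=> r0; apply: of_real_inj; rewrite of_real_modulus ger0_norm//.
by rewrite -(of_real0 R cplx) ler_of_real.
Qed.

End scalars_extra.

Section hahn_banach.
Variables (R : realType) (cplx : bool).
Local Notation K := (scalars R cplx).
Local Notation of_real := (@of_real R cplx).
Variable V : lmodType K.
Implicit Types (p q : V -> R) (x y : V).

Definition sublinear q :=
  (forall x y, q (x + y) <= q x + q y) /\
  (forall c x, 0 <= c -> q (of_real c *: x) <= c * q x).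

Lemma sublinear0 q : sublinear q -> q 0 = 0.
Proof.
move=> [qD qZ]; apply/le_anti/andP; split.
  by have := qZ 0 0 (lexx _); rewrite scaler0 mul0r.
by have := qD 0 0; rewrite addr0; lra.
Qed.

Lemma sublinearZ q c x : sublinear q -> 0 <= c -> q (of_real c *: x) = c * q x.
Proof.
move=> qs; rewrite le_eqVlt => /predU1P[<-|c0].
  by rewrite of_real0 scale0r mul0r sublinear0.
apply/le_anti/andP; split; first by apply: qs.2; exact: ltW.
rewrite -ler_pdivlMl//; set y := of_real c *: x.
rewrite [in leLHS](_ : x = of_real c^-1 *: y); last first.
  by rewrite /y scalerA -of_realM mulVf ?gt_eqF// of_real1 scale1r.
by apply: qs.2; rewrite invr_ge0 ltW.
Qed.

Lemma sublinear_ge q x : sublinear q -> - q (- x) <= q x.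
Proof. by move=> qs; have := qs.1 x (- x); rewrite subrr sublinear0//; lra. Qed.

Lemma sublinear_inf (I : Type) (A : set I) (g : I -> V -> R) :
  A !=set0 ->
  (forall x, has_lbound [set g i x | i in A]) ->
  (forall i j x y, A i -> A j -> exists2 k, A k & g k (x + y) <= g i x + g j y) ->
  (forall i c x, A i -> 0 <= c -> exists2 k, A k & g k (of_real c *: x) <= c * g i x) ->
  sublinear (fun x => inf [set g i x | i in A]).
Proof.
move=> [i0 Ai0] lb gD gZ.
have infle i x : A i -> inf [set g i x | i in A] <= g i x.
  by move=> Ai; apply: ge_inf => //; exists i.
have leinf x m : (forall i, A i -> m <= g i x) -> m <= inf [set g i x | i in A].
  move=> m_le; apply: lb_le_inf; first by exists (g i0 x), i0.
  by move=> _ [i Ai <-]; exact: m_le.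
split=> [x y|c x c0].
  rewrite -lerBlDl; apply: (leinf) => j Aj; rewrite lerBlDl -lerBlDr.
  apply: (leinf) => i Ai; rewrite lerBlDr.
  have [k Ak /(le_trans _)] := gD i j x y Ai Aj.
  by apply; exact: infle.
move: c0; rewrite le_eqVlt => /predU1P[<-|c0].
  by have [k Ak] := gZ i0 0 x Ai0 (lexx _); rewrite !mul0r; apply: le_trans; exact: infle.
rewrite -ler_pdivrMl//; apply: (leinf) => i Ai; rewrite ler_pdivrMl//.
by have [k Ak] := gZ i c x Ai (ltW c0); apply: le_trans; exact: infle.
Qed.

(* A minimal sublinear [q] satisfies [sublinear_shift q a = q], so that
   [q x <= q (x + a) - q a]: minimal sublinear functions are additive. *)
Definition sublinear_shift q a x :=
  inf [set q (x + of_real t *: a) - t * q a | t in [set t | 0 <= t]].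

Lemma sublinear_shift_lb q a x : sublinear q ->
  lbound [set q (x + of_real t *: a) - t * q a | t in [set t | 0 <= t]] (- q (- x)).
Proof.
move=> qs _ [t /= t0 <-]; rewrite -(sublinearZ a qs t0).
by have := qs.1 (x + of_real t *: a) (- x); rewrite addrAC subrr add0r; lra.
Qed.

Lemma sublinear_shift_le q a t x : sublinear q -> 0 <= t ->
  sublinear_shift q a x <= q (x + of_real t *: a) - t * q a.
Proof.
move=> qs t0; apply: ge_inf; last by exists t.
by exists (- q (- x)); exact: sublinear_shift_lb.
Qed.

Lemma sublinear_shift_sublinear q a : sublinear q -> sublinear (sublinear_shift q a).
Proof.
move=> qs; apply: (@sublinear_inf _ [set t | 0 <= t]
    (fun t x => q (x + of_real t *: a) - t * q a)).
- by exists 0 => /=.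
- by move=> x; exists (- q (- x)); exact: sublinear_shift_lb.
- move=> t s x y /= t0 s0; exists (t + s); first by rewrite /= addr_ge0.
  rewrite of_realD scalerDl addrACA.
  by have := qs.1 (x + of_real t *: a) (y + of_real s *: a); lra.
- move=> t c x /= t0 c0; exists (c * t); first by rewrite /= mulr_ge0.
  rewrite of_realM -scalerA -scalerDr.
  by have := qs.2 c (x + of_real t *: a) c0; lra.
Qed.

Lemma sublinear_minimal p : sublinear p ->
  exists q, [/\ sublinear q, (forall x, q x <= p x) &
    forall q', sublinear q' -> (forall x, q' x <= q x) -> q' = q].
Proof.
move=> ps; pose T := {q | sublinear q /\ forall x, q x <= p x}.
pose Rel (s t : T) := `[< forall x, sval t x <= sval s x >].
have [||||[q [qs qp]] qmin] := @Zorn T Rel.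
- by move=> t; apply/asboolP.
- by move=> r s t /asboolP rs /asboolP st; apply/asboolP => x; exact: le_trans (rs x).
- move=> [s sP] [t tP] /asboolP/= st /asboolP/= ts; apply: eq_exist => /=.
  by apply/funext => x; apply/le_anti; rewrite st ts.
- move=> A Atot; have [[t0 At0]|A0] := pselect (A !=set0); last first.
    exists (exist _ p (conj ps (fun x => lexx _))) => s As.
    by exfalso; apply: A0; exists s.
  have lb x : has_lbound [set sval i x | i in A].
    exists (- p (- x)) => _ [[q [qs qp]] _ <-] /=.
    by rewrite (le_trans _ (sublinear_ge _ qs))// lerN2.
  have infs : sublinear (fun x => inf [set sval i x | i in A]).
    apply: sublinear_inf => //; first by exists t0.
    + move=> i j x y Ai Aj.
      have [/asboolP ij|/asboolP ji] := Atot _ _ Ai Aj.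
        by exists j => //; rewrite (le_trans ((svalP j).1.1 _ _))// lerD2r.
      by exists i => //; rewrite (le_trans ((svalP i).1.1 _ _))// lerD2l.
    + by move=> i c x Ai c0; exists i => //; exact: (svalP i).1.2.
  have infp x : inf [set sval i x | i in A] <= p x.
    rewrite (le_trans _ ((svalP t0).2 x))//; apply: ge_inf => //.
    by exists t0.
  pose Q q := sublinear q /\ forall x, q x <= p x.
  exists (exist Q _ (conj infs infp)) => s As; apply/asboolP => x /=.
  by apply: ge_inf => //; exists s.
exists q; split=> // q' q's q'q.
have q'p x : q' x <= p x by rewrite (le_trans (q'q x)).
pose Q q := sublinear q /\ forall x, q x <= p x.
by apply: (congr1 sval (qmin (exist Q q' (conj q's q'p)) _)); exact/asboolP.
Qed.

Lemma hahn_banach_real p (z : V) : sublinear p ->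
  exists u : V -> R, [/\ forall x y, u (x + y) = u x + u y,
    forall c x, u (of_real c *: x) = c * u x,
    forall x, u x <= p x & u z = p z].
Proof.
move=> ps.
(* Minimising below [sublinear_shift p z] instead of [p] forces [u z = p z]: at [t = 1] the shift
   gives [u (- z) <= p 0 - p z]. *)
have [u [us upz umin]] := sublinear_minimal (sublinear_shift_sublinear z ps).
have ua a x : u (x + a) = u x + u a.
  have E : sublinear_shift u a = u.
    apply: umin; first exact: sublinear_shift_sublinear.
    move=> y; apply: le_trans (sublinear_shift_le _ _ us (lexx 0)) _.
    by rewrite of_real0 scale0r addr0 mul0r subr0.
  apply/le_anti/andP; split; first exact: us.1.
  have := sublinear_shift_le a x us ler01; rewrite E of_real1 scale1r mul1r.
  by rewrite lerBrDr.
have uN x : u (- x) = - u x.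
  by have := ua x (- x); rewrite addNr sublinear0//; lra.
have up x : u x <= p x.
  apply: le_trans (upz x) _; apply: le_trans (sublinear_shift_le _ _ ps (lexx 0)) _.
  by rewrite of_real0 scale0r addr0 mul0r subr0.
exists u; split=> //.
  move=> c x; have [c0|c0] := leP 0 c; first exact: sublinearZ.
  have := sublinearZ x us (_ : 0 <= - c); rewrite of_realN scaleNr uN oppr_ge0.
  by move=> /(_ (ltW c0)); lra.
apply/le_anti; rewrite up/=.
have := le_trans (upz (- z)) (sublinear_shift_le _ _ ps ler01).
by rewrite of_real1 scale1r addNr sublinear0// uN; lra.
Qed.

End hahn_banach.

(* In the complex case the functional with real part [u] is
   [x |-> u x - 'i u ('i x)], and [`|phi x|] is the real part of [phi] at a
   unimodular multiple of [x]. *)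
Lemma hahn_banach (R : realType) (cplx : bool) (V : lmodType (scalars R cplx))
  (p : V -> R) (z : V) :
  (forall x y, p (x + y) <= p x + p y) ->
  (forall a x, p (a *: x) = modulus a * p x) ->
  exists phi : V -> (scalars R cplx)^o, [/\ linear phi,
    forall x, modulus (phi x) <= p x & phi z = of_real cplx (p z)].
Proof.
move=> pD pZ.
have ps : sublinear p.
  by split=> // c x c0; rewrite pZ modulus_of_real.
have [u [uD uZ up uz]] := hahn_banach_real z ps.
case: cplx V p z pD pZ ps u uD uZ up uz => V p z pD pZ ps u uD uZ up uz.
  have uN x : u (- x) = - u x by rewrite -[u x]mul1r -mulNr -uZ /= rmorphN1 scaleN1r.
  pose phi (x : V) : (scalars R true)^o := (u x -i* u ('i%C *: x))%C.
  have phiD x y : phi (x + y) = phi x + phi y.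
    by rewrite /phi scalerDr !uD opprD.
  have phiZ (a : scalars R true) x : phi (a *: x) = a *: phi x.
    case: a => a b.
    have -> : (a +i* b)%C *: x = a%:C%C *: x + b%:C%C *: ('i%C *: x).
      rewrite scalerA -scalerDl; congr (_ *: _).
      by apply/eqP; rewrite eq_complex /=; apply/andP; split; apply/eqP; ring.
    rewrite phiD /phi.
    have uZ' : forall c x, u (c%:C%C *: x) = c * u x by [].
    have ii (v : V) : 'i%C *: ('i%C *: v) = - v.
      by rewrite scalerA -expr2 sqr_i scaleN1r.
    have sc (c : R) (v : V) : 'i%C *: (c%:C%C *: v) = c%:C%C *: ('i%C *: v).
      by rewrite !scalerA mulrC.
    rewrite !sc !uZ' ii uN.
    apply/eqP; rewrite eq_complex /=; apply/andP; split; apply/eqP; ring.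
  have modE (w : scalars R true) : modulus w ^+ 2 = complex.Re w ^+ 2 + complex.Im w ^+ 2.
    apply: (@of_real_inj R true).
    by rewrite [in LHS]expr2 of_realM of_real_modulus -expr2; exact/esym/add_Re2_Im2.
  have phile x : modulus (phi x) <= p x.
    have p0 : 0 <= p x.
      have := pD x (-1 *: x); rewrite pZ scaleN1r subrr (sublinear0 ps).
      rewrite (_ : modulus _ = 1); first by lra.
      by apply: (@of_real_inj R true); rewrite of_real_modulus normrN1 of_real1.
    have [m0|m0] := eqVneq (modulus (phi x)) 0; first by rewrite m0.
    have mp : 0 < modulus (phi x) by rewrite lt_def m0 modulus_ge0.
    pose a : scalars R true := ((phi x)^*)%C.
    have ma : modulus a = modulus (phi x).
      by apply: (@of_real_inj R true); rewrite !of_real_modulus normcJ.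
    have : complex.Re (phi (a *: x)) <= p (a *: x) by exact: up.
    rewrite phiZ pZ ma (_ : complex.Re _ = modulus (phi x) ^+ 2); last first.
      rewrite modE /a; case: (phi x) => b c /=; ring.
    by rewrite expr2 ler_pM2l.
  exists phi; split=> //; first by move=> a x y; rewrite phiD phiZ.
  have := phile z; have := modulus_ge0 (phi z); have := modE (phi z).
  rewrite -uz; set m := modulus _ => mE m0 mu.
  (* The bound [|phi z| <= p z = u z], with [u z] the real part of [phi z], leaves no room for an
     imaginary part. *)
  have I0 : u ('i%C *: z) = 0.
    apply/eqP; rewrite -sqrf_eq0 eq_le sqr_ge0 andbT.
    have : m ^+ 2 <= u z ^+ 2 by rewrite lerXn2r// nnegrE (le_trans m0).
    by rewrite mE /= sqrrN; lra.
  by apply/eqP; rewrite eq_complex /= I0 oppr0 !eqxx.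
exists u; split=> // [a x y|x].
  by rewrite uD (uZ a).
have uN : u (- x) = - u x by rewrite -[u x]mul1r -mulNr -uZ scaleN1r.
rewrite /= ler_norml up andbT lerNl -uN (le_trans (up _))//.
by rewrite -scaleN1r pZ /= normrN1 mul1r.
Qed.

(** * Functionals on a normed space and Helly's theorem *)

Section dual_extra.
Variables (R : realType) (cplx : bool).
Local Notation K := (scalars R cplx).
Local Notation of_real := (@of_real R cplx).
Variable Z : normedModType K.
Implicit Types (f g : dual Z) (x y z : Z).

Lemma dual_evalD f x y : f (x + y) = f x + f y.
Proof. by have := dual_linear f 1 x y; rewrite !scale1r. Qed.

Lemma dual_eval0 f : f 0 = 0.
Proof. by apply: (addrI (f 0)); rewrite -dual_evalD !addr0. Qed.

Lemma dual_evalZ f a x : f (a *: x) = a * f x.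
Proof. by have := dual_linear f a x 0; rewrite dual_eval0 !addr0. Qed.

Lemma dual_evalN f x : f (- x) = - f x.
Proof. by rewrite -scaleN1r dual_evalZ mulN1r. Qed.

Lemma dual_evalB f x y : f (x - y) = f x - f y.
Proof. by rewrite dual_evalD dual_evalN. Qed.

Lemma ler_dual_eval f x : `|f x| <= `|f| * `|x|.
Proof. exact: dual_norm_ub. Qed.

End dual_extra.

Section dual_hahn_banach.
Variables (R : realType) (cplx : bool).
Local Notation K := (scalars R cplx).
Local Notation of_real := (@of_real R cplx).
Variable Z : normedModType K.
Local Notation canon := (@Defs.canonical R cplx Z).
Implicit Types (f g : dual Z) (x y z : Z).

Lemma dual_of_linear (phi : Z -> K^o) (C : K) : linear phi -> 0 <= C ->
  (forall x, `|phi x| <= C * `|x|) -> exists2 g : dual Z, g =1 phi & `|g| <= C.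
Proof.
move=> lphi C0 phiC.
pose h : {linear Z -> K^o} := HB.pack phi (GRing.isLinear.Build _ _ _ _ _ lphi).
have hP : phi \in @dual_pred R cplx Z.
  rewrite inE; split=> //; apply: (@bounded_linear_continuous _ _ _ h).
  apply/bounded_funP => r; exists (C * r) => x xr /=.
  by rewrite (le_trans (phiC x))// ler_wpM2l.
exists (Dual hP) => //; apply: dual_norm_le => // x x1 /=.
by rewrite (le_trans (phiC x))// ler_piMr.
Qed.

Definition submodule_set (V : lmodType K) (M : set V) :=
  M 0 /\ forall (a : K) (x y : V), M x -> M y -> M (a *: x + y).

(** Hahn-Banach for the distance to [M], a seminorm vanishing on [M]; the functional is then divided
    by its value at [z], which is at least [d]. *)
Lemma dual_separation (M : set Z) (z : Z) (d : K) : submodule_set M -> 0 < d ->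
  (forall m, M m -> d <= `|z - m|) ->
  exists g : dual Z, [/\ forall m, M m -> g m = 0, g z = 1 & `|g| <= d^-1].
Proof.
move=> [M0 MD] d0 dz; pose nm (x : Z) : R := modulus `|x|.
have nmE x : of_real (nm x) = `|x| by rewrite of_real_modulus normr_id.
pose p (x : Z) := inf [set nm (x - m) | m in M].
have lb x : has_lbound [set nm (x - m) | m in M].
  by exists 0 => _ [m _ <-]; exact: modulus_ge0.
have ple x m : M m -> p x <= nm (x - m) by move=> Mm; apply: ge_inf => //; exists m.
have lep x c : (forall m, M m -> c <= nm (x - m)) -> c <= p x.
  move=> cle; apply: lb_le_inf; first by exists (nm (x - 0)), 0.
  by move=> _ [m Mm <-]; exact: cle.
have MZ a x : M x -> M (a *: x) by move=> Mx; rewrite -[_ *: _]addr0; exact: MD.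
have pD x y : p (x + y) <= p x + p y.
  rewrite -lerBlDl; apply: (lep) => m Mm; rewrite lerBlDl -lerBlDr.
  apply: (lep) => n Mn; rewrite lerBlDr; apply: (le_trans (ple _ (n + m) _)).
    by rewrite -[n]scale1r; exact: MD.
  rewrite -(ler_of_real cplx) of_realD !nmE opprD addrACA; exact: ler_normD.
have pZle a x : p (a *: x) <= modulus a * p x.
  have [a0|a0] := eqVneq (modulus a) 0.
    rewrite a0 mul0r (_ : a = 0); last first.
      by apply/eqP; rewrite -normr_eq0 -of_real_modulus a0 of_real0.
    rewrite scale0r (le_trans (ple _ _ M0))// subrr -(ler_of_real cplx) nmE.
    by rewrite normr0 of_real0.
  have ap : 0 < modulus a by rewrite lt_def a0 modulus_ge0.
  rewrite -ler_pdivrMl//; apply: (lep) => m Mm; rewrite ler_pdivrMl//.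
  rewrite (le_trans (ple _ _ (MZ a _ Mm)))// -scalerBr.
  by rewrite -(ler_of_real cplx) of_realM !nmE of_real_modulus normrZ.
have pZ a x : p (a *: x) = modulus a * p x.
  apply/le_anti; rewrite pZle/=.
  have [->|a0] := eqVneq a 0.
    rewrite scale0r (_ : modulus _ = 0) ?mul0r.
      by apply: (lep) => m _; exact: modulus_ge0.
    by apply: (@of_real_inj R cplx); rewrite of_real_modulus normr0 of_real0.
  rewrite -[in leLHS](scalerK a0 x).
  apply: (le_trans (ler_wpM2l (modulus_ge0 _) (pZle _ _))).
  rewrite mulrA -modulusM mulfV// (_ : modulus 1 = 1) ?mul1r//.
  by apply: (@of_real_inj R cplx); rewrite of_real_modulus normr1 of_real1.
have [phi [lphi phip phiz]] := hahn_banach z pD pZ.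
have dpz : modulus d <= p z.
  apply: (lep) => m Mm; rewrite -(ler_of_real cplx) nmE -(ger0_of_realE (ltW d0)).
  exact: dz.
have dE : d = of_real (modulus d) by apply: ger0_of_realE; exact: ltW.
have phizd : d <= phi z by rewrite phiz dE ler_of_real.
have phiz0 : 0 < phi z by exact: lt_le_trans phizd.
have phile x : `|phi x| <= `|x|.
  rewrite -of_real_modulus -nmE ler_of_real (le_trans (phip x))//.
  by rewrite (le_trans (ple _ _ M0))// subr0.
have [||x|g gE gd] := @dual_of_linear (fun x => (phi z)^-1 *: phi x) d^-1.
- by move=> a x y; rewrite lphi scalerDr !scalerA mulrC.
- by rewrite invr_ge0 ltW.
- rewrite normrZ ler_pM ?normr_ge0// normfV lef_pV2 ?posrE ?normr_gt0 ?gt_eqF//.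
  by rewrite (le_trans phizd)// real_ler_norm// gtr0_real.
exists g; split=> //; last by rewrite gE; exact: mulVf (lt0r_neq0 _).
move=> m Mm; rewrite gE (_ : phi m = 0) ?scaler0//.
apply/eqP; rewrite -normr_le0 -of_real_modulus -(of_real0 R cplx) ler_of_real.
rewrite (le_trans (phip m))// (le_trans (ple _ _ Mm))// subrr.
by rewrite -(ler_of_real cplx) nmE normr0 of_real0.
Qed.

Lemma dual_norming z : exists2 g : dual Z, g z = `|z| & `|g| <= 1.
Proof.
have [->|z0] := eqVneq z 0.
  by exists 0; rewrite ?normr0.
have zp : 0 < `|z| by rewrite normr_gt0.
have [||m ->|g [_ gz gn]] := @dual_separation [set 0] z `|z|.
- by split=> // a x y -> ->; rewrite scaler0 addr0.
- by [].
- by rewrite subr0.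
exists (`|z| *: g); first by rewrite dualZE gz; exact: mulr1.
by rewrite normrZ normr_id -ler_pdivlMl// mulr1.
Qed.

Lemma norm_canonical z : `|canon z| = `|z|.
Proof.
apply/le_anti/andP; split.
  by apply: dual_norm_le => // f f1 /=; rewrite (le_trans (ler_dual_eval f z))// ler_piMl.
have [g gz g1] := dual_norming z.
rewrite -[leLHS]normr_id -gz -[g z]/(canon z g).
by rewrite (le_trans (ler_dual_eval (canon z) g))// ler_piMr.
Qed.

(** The hypothesis makes [g] a linear combination of [l]. The induction eliminates [h] by
    subtracting from [g] the multiple of [h] that agrees with it at a point [z] where the other
    functionals vanish and [h] does not; without such a point [h] is redundant. *)
Lemma bidual_vanish (l : seq (dual Z)) g (Psi : dual (dual Z)) :
  (forall z, (forall f, f \in l -> f z = 0) -> g z = 0) ->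
  (forall f, f \in l -> Psi f = 0) -> Psi g = 0.
Proof.
elim: l g => [|h l IH] g gl Psil.
  have -> : g = 0 by apply: dual_eqP => z; rewrite gl.
  exact: dual_eval0.
have Psil' f : f \in l -> Psi f = 0 by move=> fl; rewrite Psil// inE fl orbT.
have [[z [zl hz]]|nz] := pselect (exists z, (forall f, f \in l -> f z = 0) /\ h z <> 0).
  have : Psi (g - (g z / h z) *: h) = 0.
    apply: IH => // w wl; rewrite -[RHS](gl (w - (h w / h z) *: z)); last first.
      move=> f; rewrite inE => /predU1P[->|fl]; last first.
        by rewrite dual_evalB dual_evalZ (wl f fl) (zl f fl) mulr0 subr0.
      by rewrite dual_evalB dual_evalZ divfK ?subrr//; exact/eqP.
    rewrite dual_evalB dual_evalZ.
    change (g w - g z / h z * h w = g w - h w / h z * g z); congr (_ - _).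
    by rewrite -mulrA [RHS]mulrC [_^-1 * _]mulrC.
  by rewrite dual_evalB dual_evalZ (Psil h (mem_head _ _)) mulr0 subr0.
apply: IH => // z zl; apply: gl => f; rewrite inE => /predU1P[->|]; last exact: zl.
by apply/eqP; apply/negP => /negP/eqP hz; apply: nz; exists z.
Qed.

Lemma bidual_interpolation (l : seq (dual Z)) (Phi : dual (dual Z)) :
  exists z, forall f, f \in l -> f z = Phi f.
Proof.
elim: l => [|g l [z zl]]; first by exists 0.
have [[w [wl gw]]|nw] := pselect (exists w, (forall f, f \in l -> f w = 0) /\ g w <> 0).
  have gw0 : g w != 0 by exact/eqP.
  exists (z + ((Phi g - g z) / g w) *: w) => f.
  rewrite dual_evalD dual_evalZ inE => /predU1P[->|fl]; last first.
    by rewrite (zl f fl) (wl f fl) mulr0 addr0.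
  by rewrite divfK // addrC subrK.
exists z => f; rewrite inE => /predU1P[->|]; last exact: zl.
apply/eqP; rewrite eq_sym -subr_eq0; apply/eqP.
have := @bidual_vanish l g (Phi - canon z); apply.
  move=> w wl; apply/eqP; apply/negP => /negP/eqP gw.
  by apply: nw; exists w.
by move=> h hl; change (Phi h - h z = 0); rewrite (zl h hl) subrr.
Qed.

(** The solutions of the finite system form a coset of [M]. If none had norm at most [|Phi| + e],
    some [g] of norm at most [(|Phi| + e)^-1] would vanish on [M] with [g z = 1]; by [bidual_vanish]
    also [Phi g = 1], which is too large. *)
Lemma helly (l : seq (dual Z)) (Phi : dual (dual Z)) (e : K) : 0 < e ->
  exists2 z, forall f, f \in l -> f z = Phi f & `|z| <= `|Phi| + e.
Proof.
move=> e0; have [z zl] := bidual_interpolation l Phi.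
pose M := [set m : Z | forall f, f \in l -> f m = 0].
have d0 : 0 < `|Phi| + e by rewrite ltr_wpDl.
have [[m [Mm zm]]|far] := pselect (exists m, M m /\ `|z - m| <= `|Phi| + e).
  exists (z - m) => // f fl; by rewrite dual_evalB (zl f fl) (Mm f fl) subr0.
exfalso.
have [|m Mm|g [gM gz gn]] := @dual_separation M z (`|Phi| + e) _ d0.
- split=> [f _|a x y Mx My f fl]; first exact: dual_eval0.
  by rewrite dual_evalD dual_evalZ (Mx f fl) (My f fl) mulr0 addr0.
- have := real_leP (normr_real (z - m)) (ger0_real (ltW d0)).
  case=> [zm|/ltW//]; by exfalso; apply: far; exists m.
have : Phi g - g z = 0.
  apply: (@bidual_vanish l g (Phi - canon z)) => [w wl|f fl]; first exact: gM.
  by change (Phi f - f z = 0); rewrite (zl f fl) subrr.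
move=> /eqP; rewrite subr_eq0 => /eqP; rewrite gz => Phig.
have := le_trans (ler_dual_eval Phi g) (ler_wpM2l (normr_ge0 _) gn).
rewrite Phig normr1 ler_pdivlMr// mul1r.
by rewrite gerDl (lt_geF e0).
Qed.

End dual_hahn_banach.

(** * Biorthogonal functionals on the bidual modulo the space *)

Section finite_codimension.
Variables (R : realType) (cplx : bool).
Local Notation K := (scalars R cplx).
Variable V : normedModType K.
Variable W : set V.
Hypothesis Wsub : submodule_set W.
Implicit Types (l : seq V) (u z : V).

Fixpoint add_span l : set V :=
  if l is z :: l' then [set u | exists c : K, add_span l' (u - c *: z)] else W.

Lemma add_span_submodule l : submodule_set (add_span l).
Proof.
elim: l => [//|z l [IH0 IHD]]; split; first by exists 0; rewrite scale0r subr0.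
move=> a x y [c xc] [d yd]; exists (a * c + d).
rewrite scalerDl opprD addrACA -scalerA -scalerBr; exact: IHD.
Qed.

Lemma add_spanW l u : W u -> add_span l u.
Proof. by elim: l => [//|z l IH Wu] /=; exists 0; rewrite scale0r subr0; exact: IH. Qed.

Lemma mem_add_span l z : z \in l -> add_span l z.
Proof.
elim: l => [//|y l IH]; rewrite inE => /predU1P[->|zl].
  by exists 1; rewrite scale1r subrr; have [] := add_span_submodule l.
by exists 0; rewrite scale0r subr0; exact: IH.
Qed.

Lemma finite_dim_add_span l :
  (forall u, add_span l u) -> finite_dim_quotient W.
Proof.
move=> full; exists (size l), (fun i => nth 0 l i) => u.
move: (full u); elim: l {full} u => [u Wu|z l IH u [c /IH[d Wd]]].
  by exists (fun=> 0); rewrite big_ord0 subr0.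
exists (fun i => if unlift ord0 i is Some j then d j else c).
rewrite big_ord_recl unlift_none /= opprD addrA.
by under eq_bigr do rewrite liftK.
Qed.

(** One more functional costs at most one more spanning vector: a point [z] of the other kernels at
    which it does not vanish. *)
Lemma finite_dim_kernels (Psis : seq (dual V)) l :
  (forall u, (forall Psi, Psi \in Psis -> Psi u = 0) -> add_span l u) ->
  finite_dim_quotient W.
Proof.
elim: Psis l => [|Psi Psis IH] l ker.
  by apply: (@finite_dim_add_span l) => u; exact: ker.
have [[z [zk Psiz]]|nz] := pselect (exists z,
    (forall Psi', Psi' \in Psis -> Psi' z = 0) /\ Psi z <> 0).
  apply: (IH (z :: l)) => u uk /=; exists (Psi u / Psi z); apply: ker => Psi'.
  rewrite dual_evalB dual_evalZ inE => /predU1P[->|Psi'k].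
    by rewrite divfK ?subrr//; exact/eqP.
  by rewrite (uk _ Psi'k) (zk _ Psi'k) mulr0 subr0.
apply: (IH l) => u uk; apply: ker => Psi'; rewrite inE => /predU1P[->|]; last exact: uk.
by apply/eqP; apply/negP => /negP/eqP uz; apply: nz; exists u.
Qed.

(** Induction on [l]: when [z] is new, [psi1] separates it from the rest and [psi2] separates
    [u - psi1 u *: z]; then [psi2 - psi2 z *: psi1] kills [z] too and is 1 at [u]. *)
Lemma add_span_separation l u :
  (forall u, ~ W u -> exists psi : dual V, (forall w, W w -> psi w = 0) /\ psi u = 1) ->
  ~ add_span l u ->
  exists psi : dual V, (forall w, add_span l w -> psi w = 0) /\ psi u = 1.
Proof.
move=> sepW; elim: l u => [|z l IH] u; first exact: sepW.
move=> nu; have [lz|/IH[psi1 [psi1l psi1z]]] := pselect (add_span l z).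
  have [|psi [psil psiu]] := IH u.
    by move=> lu; apply: nu; exists 0; rewrite scale0r subr0.
  exists psi; split=> // w [c /psil].
  by rewrite dual_evalB dual_evalZ (psil _ lz) mulr0 subr0.
have [|psi2 [psi2l psi2u]] := IH (u - psi1 u *: z).
  by move=> lu; apply: nu; exists (psi1 u).
exists (psi2 - psi2 z *: psi1); split.
  move=> w [c lw]; have := psi1l _ lw; have := psi2l _ lw.
  rewrite !dual_evalB !dual_evalZ psi1z mulr1 => /eqP; rewrite subr_eq0 => /eqP w2.
  move=> /eqP; rewrite subr_eq0 => /eqP w1.
  change (psi2 w - psi2 z * psi1 w = 0).
  by rewrite w2 w1 mulrC subrr.
rewrite -psi2u dual_evalB dual_evalZ.
change (psi2 u - psi2 z * psi1 u = psi2 u - psi1 u * psi2 z).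
by rewrite [in RHS]mulrC.
Qed.

End finite_codimension.

Section bidual.
Variables (R : realType) (cplx : bool).
Local Notation K := (scalars R cplx).
Variable X : completeNormedModType K.
Local Notation canon := (@Defs.canonical R cplx X).

Lemma canonicalD x y : canon (x + y) = canon x + canon y.
Proof. by apply: dual_eqP => f; exact: dual_evalD. Qed.

Lemma canonicalZ a x : canon (a *: x) = a *: canon x.
Proof. by apply: dual_eqP => f; exact: dual_evalZ. Qed.

Lemma canonicalB x y : canon (x - y) = canon x - canon y.
Proof. by apply: dual_eqP => f; exact: dual_evalB. Qed.

Lemma range_canonical_submodule : submodule_set (range canon).
Proof.
split; first by exists 0 => //; apply: dual_eqP => f; exact: dual_eval0.
move=> a _ _ [x _ <-] [y _ <-]; exists (a *: x + y) => //.
by rewrite canonicalD canonicalZ.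
Qed.

(** Completeness of [X] enters here: [X] is closed in its bidual, since the points whose images
    approach [u] would form a Cauchy filter, and its limit would be mapped to [u]. *)
Lemma canonical_dist (u : dual (dual X)) : ~ range canon u ->
  exists2 d : K, 0 < d & forall x, d <= `|u - canon x|.
Proof.
move=> nu; have [//|not_far] := pselect (exists2 d : K, 0 < d &
  forall x, d <= `|u - canon x|).
have near_u (d : K) : 0 < d -> exists x, `|u - canon x| < d.
  move=> d0; have [//|far] := pselect (exists x, `|u - canon x| < d).
  exfalso; apply: not_far; exists d => // x.
  have [//|xd] := real_leP (gtr0_real d0) (normr_real (u - canon x)).
  by exfalso; apply: far; exists x.
exfalso; pose F : set_system X :=
  filter_from [set d : K | 0 < d] (fun d => [set x | `|u - canon x| < d]).
have FF : ProperFilter F.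
  apply: filter_from_proper; last first.
    by move=> r /= r0; have [x xr] := near_u _ r0; exists x.
  apply: filter_from_filter; first by exists 1 => /=.
  move=> d e /= d0 e0.
  have [de|ed] := real_leP (gtr0_real d0) (gtr0_real e0).
    by exists d => // x /= xd; split=> //=; exact: lt_le_trans de.
  by exists e => // x /= xe; split=> //=; exact: lt_trans ed.
have cF : cauchy F.
  apply: cauchy_exP => e e0.
  have e20 : 0 < e / 2 by rewrite divr_gt0.
  have [x0 x0e] := near_u _ e20; exists x0; exists (e / 2) => // x /= xe.
  rewrite -ball_normE /= -norm_canonical canonicalB [e]splitr.
  rewrite -(subrKA u) (le_lt_trans (ler_normD _ _))//.
  by rewrite ltrD// distrC.
have /cvg_ex[x Fx] : cvg F by exact: cauchy_cvg.
apply: nu; exists x => //; apply/eqP; rewrite eq_sym -subr_eq0 -normr_le0.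
apply/ler_addgt0Pr => e e0; rewrite add0r.
have e20 : 0 < e / 2 by rewrite divr_gt0.
have [y [xy uy]] : (ball x (e / 2) `&` [set y | `|u - canon y| < e / 2]) !=set0.
  apply: (@filter_ex _ F); apply: filterI; last by exists (e / 2).
  by apply: Fx; exact: nbhsx_ballx.
move: xy; rewrite -ball_normE /= -norm_canonical canonicalB => xy.
rewrite (splitr e).
apply: (@le_trans _ _ (`|u - canon y| + `|canon y - canon x|)).
  exact: ler_distD.
apply: lerD.
  exact: (ltW uy).
rewrite distrC.
exact: (ltW xy).
Qed.

Lemma canonical_separation (u : dual (dual X)) : ~ range canon u ->
  exists psi : dual (dual (dual X)),
    (forall w, range canon w -> psi w = 0) /\ psi u = 1.
Proof.
move=> /canonical_dist[d d0 ud].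
have ud' w : range canon w -> d <= `|u - w| by move=> [x _ <-].
have [psi [psiW psiu _]] := dual_separation range_canonical_submodule d0 ud'.
by exists psi.
Qed.

(** The common kernel of [Psis] has finite codimension, so it cannot lie in [X] plus the span of
    [Gs]; any [G] outside is separated from that space by some [phi]. Rescaling makes [G] small at
    the expense of the norm of [phi]. *)
Lemma biorthogonal_extension (Psis : seq (dual (dual (dual X))))
    (Gs : seq (dual (dual X))) (e : K) : ~ quasireflexive X -> 0 < e ->
  exists (G : dual (dual X)) (phi : dual (dual (dual X))),
    [/\ `|G| <= e, forall Psi, Psi \in Psis -> Psi G = 0,
      forall x, phi (canon x) = 0, forall H, H \in Gs -> phi H = 0 & phi G = 1].
Proof.
move=> nqr e0; have Wsub := range_canonical_submodule.
have [G [PsiG nG]] : exists G : dual (dual X),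
    (forall Psi, Psi \in Psis -> Psi G = 0) /\ ~ add_span (range canon) Gs G.
  apply/not_existsP => nex; apply: nqr.
  apply: (@finite_dim_kernels _ _ (dual (dual X)) _ Psis Gs) => u uk.
  by apply: contrapT => nu; apply: (nex u).
have [phi [phi0 phiG]] := add_span_separation canonical_separation nG.
have G0 : G != 0.
  by apply/eqP => G0; move: phiG; rewrite G0 dual_eval0 => /eqP; rewrite eq_sym oner_eq0.
have nG0 : 0 < `|G| by rewrite normr_gt0.
have c0 : e / `|G| != 0 by rewrite mulf_neq0 ?invr_neq0 ?lt0r_neq0.
exists ((e / `|G|) *: G), ((e / `|G|)^-1 *: phi); split.
- by rewrite normrZ ger0_norm ?divfK ?gt_eqF// divr_ge0 ?ltW.
- by move=> Psi PsiP; rewrite dual_evalZ (PsiG _ PsiP) mulr0.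
- by move=> x; rewrite dualZE phi0 ?scaler0//; apply: add_spanW; exists x.
- by move=> H HG; rewrite dualZE phi0 ?scaler0//; exact: mem_add_span.
- by rewrite dual_evalZ dualZE phiG [_ *: _]mulr1 mulfV.
Qed.

End bidual.

(** * A weak* dense sequence in the dual ball *)

Section scalars_approximation.
Variables (R : realType) (cplx : bool).
Local Notation K := (scalars R cplx).

Lemma half_gt0 n : 0 < (2^-1 : K) ^+ n.
Proof. by rewrite exprn_gt0// invr_gt0 ltr0n. Qed.

Lemma half_lt (e : K) : 0 < e -> exists n, (2^-1 : K) ^+ n < e.
Proof.
move=> e0; have eE := ger0_of_realE (ltW e0).
have r0 : 0 < modulus e.
  by rewrite lt_def modulus_ge0 andbT; apply: contraTneq e0 => r0; rewrite eE r0 of_real0 ltxx.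
pose n := Num.bound (modulus e)^-1; exists n.
have nR : ((2^-1 : R) ^+ n < modulus e).
  rewrite exprVn invf_plt ?posrE ?exprn_gt0//.
  apply: lt_trans (archi_boundP _) _; first by rewrite invr_ge0 modulus_ge0.
  by rewrite -natrX ltr_nat ltn_expl.
have hE : (2^-1 : K) ^+ n = of_real cplx ((2^-1 : R) ^+ n).
  by case: cplx => //=; rewrite rmorphXn fmorphV rmorph_nat.
by rewrite hE eE lt_neqAle ler_of_real (ltW nR) andbT (inj_eq (@of_real_inj R cplx)) (lt_eqF nR).
Qed.

Lemma floor_dist (r a b : R) : 0 < r -> Num.floor (a / r) = Num.floor (b / r) ->
  `|a - b| < r.
Proof.
move=> r0 ab; have := floor_itv (a / r); have := floor_itv (b / r); rewrite ab.
move=> /andP[b1 b2] /andP[a1 a2]; rewrite ltr_norml.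
move: a1 a2 b1 b2; rewrite intrD !(ler_pdivlMr, ltr_pdivrMr)//.
set k : R := _%:~R; rewrite mulrDl mul1r; lra.
Qed.

Lemma scalars_discretization (e : K) : 0 < e ->
  exists kappa : K -> int * int, forall a b, kappa a = kappa b -> `|a - b| < e.
Proof.
case: cplx e => /= e e0; last first.
  by exists (fun a => (Num.floor (a / e), 0)) => a b [] /floor_dist; exact.
case: e e0 => e e'; rewrite ltcE /= => /andP[/eqP ie e0]; subst e'.
have e20 : 0 < e / 2 by rewrite divr_gt0.
exists (fun a : R[i] =>
  (Num.floor (complex.Re a / (e / 2)), Num.floor (complex.Im a / (e / 2)))).
move=> [a1 a2] [b1 b2] [] /= /(floor_dist e20) ab1 /(floor_dist e20) ab2.
exact: normc_lt.
Qed.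

End scalars_approximation.

Section dense_sequences.
Variables (R : realType) (cplx : bool).
Local Notation K := (scalars R cplx).
Variable X : normedModType K.

Definition dense_seq (v : nat -> X) :=
  forall x (e : K), 0 < e -> exists i, `|x - v i| < e.

Lemma separable_dense_seq : separable X -> exists v, dense_seq v.
Proof.
move=> [S /ppcard_leP[g] dS].
exists (fun n => xget 0 [set x | S x /\ g x = n]) => x e e0.
have [||y [xy Sy]] := dS (ball x e); first by exists x; exact: ballxx.
  exact: ball_open.
exists (g y); case: xgetP => [z _ [Sz gz]|/(_ y)]; last by case.
have -> : z = y by apply: (@inj _ _ S g) => //; exact/mem_set.
by move: xy; rewrite -ball_normE.
Qed.

Lemma dense_seq_finite (v : nat -> X) (l : seq X) (e : K) : dense_seq v -> 0 < e ->
  exists n, forall x, x \in l -> exists2 i, (i < n)%N & `|x - v i| < e.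
Proof.
move=> vd e0; elim: l => [|y l [n nl]]; first by exists 0%N.
have [i yi] := vd y _ e0; exists (maxn n i.+1) => x.
rewrite inE => /predU1P[->|/nl[j jn xj]].
  by exists i => //; rewrite leq_max leqnn orbT.
by exists j => //; rewrite leq_max jn.
Qed.

Definition weak_star_dense_ball (f : nat -> dual X) :=
  forall (g : dual X) (l : seq X) (e : K), `|g| <= 1 -> 0 < e ->
    exists j, forall x, x \in l -> `|g x - f j x| < e.

(** One representative is taken from each class of unit-ball functionals whose values at [v 0], ...,
    [v (n - 1)] lie in the same cells of size [2^-m]. The triples [(n, m, c)] are countable, and the
    norm bound transfers closeness from the dense [v i] to arbitrary points. *)
Lemma exists_weak_star_dense_ball : separable X ->
  exists f : nat -> dual X, (forall j, `|f j| <= 1) /\ weak_star_dense_ball f.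
Proof.
move=> /separable_dense_seq[v vd].
have /choice[kappa kappaP] : forall m, exists kappa : K -> int * int,
    forall a b, kappa a = kappa b -> `|a - b| < (2^-1 : K) ^+ m.
  by move=> m; apply: scalars_discretization; exact: half_gt0.
pose code n m (g : dual X) := [seq kappa m (g (v i)) | i <- iota 0 n].
pose rep n m c : dual X := xget 0 [set g | `|g| <= 1 /\ code n m g = c].
have rep1 n m c : `|rep n m c| <= 1.
  by rewrite /rep; case: xgetP => [g _ []|] //; rewrite normr0 ler01.
exists (fun j => if (unpickle j : option (nat * nat * seq (int * int))) is Some (n, m, c)
  then rep n m c else 0).
split=> [j|g l e g1 e0].
  by case: unpickle => [[[n m] c]|]; rewrite ?rep1// normr0 ler01.
have e30 : 0 < e / 3 by rewrite divr_gt0.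
have [n nl] := dense_seq_finite l vd e30.
have [m me] := half_lt e30.
exists (pickle (n, m, code n m g)); rewrite pickleK => x /nl[i ni xi].
have [r1 rc] : `|rep n m (code n m g)| <= 1 /\ code n m (rep n m (code n m g)) = code n m g.
  by rewrite /rep; case: xgetP => [h _ //|/(_ g)]; case.
set r := rep _ _ _ in r1 rc *.
have gr : `|g (v i) - r (v i)| < e / 3.
  apply: lt_trans me; apply: kappaP.
  have := congr1 (nth (0, 0) ^~ i) rc.
  by rewrite !(nth_map 0%N) ?size_iota// nth_iota// => ->.
have bd (h : dual X) : `|h| <= 1 -> `|h (x - v i)| < e / 3.
  move=> h1; apply: le_lt_trans xi; apply: (le_trans (ler_dual_eval h _)).
  by apply: ler_piMl.
have -> : g x - r x = g (x - v i) + (g (v i) - r (v i)) - r (x - v i).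
  by rewrite !dual_evalB; ring.
have -> : e = e / 3 + e / 3 + e / 3 by field.
apply: (le_lt_trans (ler_normB _ _)); apply: ltrD; last exact: bd.
by apply: (le_lt_trans (ler_normD _ _)); apply: ltrD => //; exact: bd.
Qed.

End dense_sequences.

(** * Biorthogonal systems in separable non-quasireflexive spaces *)

Section weak_system.
Variables (R : realType) (cplx : bool).
Local Notation K := (scalars R cplx).
Local Notation half := (2^-1 : K).

(* For fixed [s], the bounded sequence [y s] mimics a functional [G s] of the
   bidual outside [X], and [e s n] is a bounded weak* null sequence in [n] on
   which [G s] is 1, while [G t] vanishes on it for [t != s]. *)
Record weak_system (X : normedModType K) (y : nat -> nat -> X)
    (e : nat -> nat -> dual X) (f : nat -> dual X) : Prop := WeakSystem {
  ws_norm : forall s m, `|y s m| <= half ^+ s;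
  ws_eval : forall s n t m, (s <= n)%N ->
    e s n (y t m) = ((s == t) && (n < m)%N)%:R;
  ws_bounded : forall s, exists L : K, forall n, (s <= n)%N -> `|e s n| <= L;
  ws_null : forall s x (r : K), 0 < r ->
    exists N, forall n, (N <= n)%N -> `|e s n x| < r;
  ws_stationary : forall j s m m', (j < m)%N -> (j < m')%N ->
    f j (y s m) = f j (y s m');
  ws_vanish : forall j s m, (j < s)%N -> f j (y s m) = 0;
  ws_ball : forall j, `|f j| <= 1;
  ws_dense : weak_star_dense_ball f }.

Variable X : completeNormedModType K.
Local Notation canon := (@Defs.canonical R cplx X).

(** Stage [n] supplies the [n]-th functional [G], its biorthogonal partner [phi], and the terms
    [y s n] and [e s n] for all [s <= n] at once. *)
Record stage := Stage {
  stG : dual (dual X);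
  stphi : dual (dual (dual X));
  sty : nat -> X;
  ste : nat -> dual X }.

Variables (v : nat -> X) (f : nat -> dual X).
Implicit Types (h : seq stage) (st : stage).

Definition stage_duals h : seq (dual X) :=
  [seq f i | i <- iota 0 (size h)] ++
  flatten [seq [seq ste i s | s <- iota 0 (size h)] | i <- h].

Definition stage_points h (y : nat -> X) : seq X :=
  [seq v i | i <- iota 0 (size h)] ++
  flatten [seq [seq sty i s | s <- iota 0 (size h).+1] | i <- h] ++
  [seq y s | s <- iota 0 (size h).+1].

(** The default value of [nth] is the functional under construction, so index [size h] denotes the
    new stage and smaller indices the earlier ones. *)
Record next_stage h st : Prop := NextStage {
  nsG : `|stG st| <= half ^+ (size h).+1;
  nsG0 : forall d, d \in stage_duals h -> stG st d = 0;
  nsGphi : forall i, i \in map stphi h -> i (stG st) = 0;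
  nsphi0 : forall x, stphi st (canon x) = 0;
  nsphiG : forall H, H \in map stG h -> stphi st H = 0;
  nsphi1 : stphi st (stG st) = 1;
  nsy : forall s d, d \in stage_duals h ->
    d (sty st s) = nth (stG st) (map stG h) s d;
  nsyb : forall s, `|sty st s| <= `|nth (stG st) (map stG h) s| + half ^+ s.+1;
  nse : forall s H, H \in rcons (map stG h) (stG st) ->
    H (ste st s) = nth (stphi st) (map stphi h) s H;
  nse0 : forall s x, x \in stage_points h (sty st) ->
    ste st s x = nth (stphi st) (map stphi h) s (canon x);
  nseb : forall s, `|ste st s| <= `|nth (stphi st) (map stphi h) s| + 1 }.

(** [G] and [phi] come first. Helly's theorem in [X] then yields points imitating each [G] on the
    earlier functionals; Helly's theorem in the dual yields functionals imitating each [phi] on the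
    points known so far, the new ones included, and on each [G]. *)
Lemma exists_next_stage h : ~ quasireflexive X -> exists st, next_stage h st.
Proof.
move=> nqr.
have [G [phi [Gn PsiG phi0 phiG phi1]]] := biorthogonal_extension
  ([seq @Defs.canonical _ _ _ d | d <- stage_duals h] ++ map stphi h) (map stG h) nqr
  (half_gt0 R cplx (size h).+1).
have /choice[y yP] : forall s, exists x : X,
    (forall d, d \in stage_duals h -> d x = nth G (map stG h) s d) /\
    `|x| <= `|nth G (map stG h) s| + half ^+ s.+1.
  move=> s; have [x xd xn] := helly (stage_duals h) (nth G (map stG h) s)
    (half_gt0 R cplx s.+1).
  by exists x.
have /choice[e eP] : forall s, exists g : dual X,
    (forall H, H \in [seq canon x | x <- stage_points h y] ++ rcons (map stG h) G ->
       H g = nth phi (map stphi h) s H) /\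
    `|g| <= `|nth phi (map stphi h) s| + 1.
  move=> s; have [g gH gn] := helly
    ([seq canon x | x <- stage_points h y] ++ rcons (map stG h) G)
    (nth phi (map stphi h) s) ltr01.
  by exists g.
exists (Stage G phi y e); split=> //=.
- move=> d dh; apply: (PsiG (@Defs.canonical _ _ _ d)).
  by rewrite mem_cat map_f.
- by move=> i ih; apply: PsiG; rewrite mem_cat ih orbT.
- by move=> s; exact: (yP s).1.
- by move=> s; exact: (yP s).2.
- by move=> s H HG; apply: (eP s).1; rewrite mem_cat HG orbT.
- by move=> s x xh; apply: ((eP s).1 (canon x)); rewrite mem_cat map_f.
- by move=> s; exact: (eP s).2.
Qed.

Lemma exists_weak_system_aux : ~ quasireflexive X -> dense_seq v ->
  (forall j, `|f j| <= 1) -> weak_star_dense_ball f ->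
  exists y e, weak_system y e f.
Proof.
move=> nqr vd f1 fd.
have /choice[pick pickP] := fun h => exists_next_stage h nqr.
pose hist := fix hist n := if n is m.+1 then rcons (hist m) (pick (hist m)) else [::].
pose S n := pick (hist n).
have histE n : hist n = mkseq S n by elim: n => //= n IH; rewrite /S mkseqS -IH.
have size_h n : size (hist n) = n by rewrite histE size_mkseq.
have SP n : next_stage (hist n) (S n) by exact: pickP.
have map_h (T : Type) (g : stage -> T) n : map g (hist n) = mkseq (g \o S) n.
  by rewrite histE /mkseq -map_comp.
have nth_h (T : Type) (g : stage -> T) n s : (s <= n)%N ->
    nth (g (S n)) (map g (hist n)) s = g (S s).
  rewrite map_h leq_eqVlt => /predU1P[->|sn]; last by rewrite nth_mkseq.
  by rewrite nth_default// size_mkseq.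
have mem_h (T : eqType) (F : stage -> seq T) n i x : (i < n)%N -> x \in F (S i) ->
    x \in flatten [seq F st | st <- hist n].
  move=> ni xi; rewrite histE -map_comp; apply/flattenP; exists (F (S i)) => //.
  by apply/mapP; exists i; rewrite ?mem_iota.
pose G s := stG (S s); pose phi s := stphi (S s).
pose y s m := if (s <= m)%N then sty (S m) s else 0.
pose e s n := ste (S n) s.
have mem_e s n t : (s <= n)%N -> (n < t)%N -> e s n \in stage_duals (hist t).
  move=> sn nt; rewrite mem_cat; apply/orP; right.
  apply: (mem_h _ _ t n) => //; apply/mapP; exists s => //.
  by rewrite mem_iota size_h /= (leq_ltn_trans sn).
have mem_f j t : (j < t)%N -> f j \in stage_duals (hist t).
  by move=> jt; rewrite mem_cat map_f// mem_iota size_h.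
have phiG s t : phi s (G t) = (s == t)%:R.
  have [st|ts|->] := ltngtP s t; last exact: nsphi1 (SP t).
    apply: (nsGphi (SP t)); rewrite map_h; apply/mapP; exists s => //.
    by rewrite mem_iota.
  apply: (nsphiG (SP s)); rewrite map_h; apply/mapP; exists t => //.
  by rewrite mem_iota.
(* For [t > n] the functional [G t] was chosen to kill [e s n]; for [t <= n], [e s n] was chosen to
   act on [G t] as [phi s] does. *)
have Ge s n t : (s <= n)%N -> G t (e s n) = (s == t)%:R.
  move=> sn; have [tn|nt] := leqP t n; last first.
    rewrite (nsG0 (SP t) (mem_e _ _ _ sn nt)).
    by rewrite (ltn_eqF (leq_ltn_trans sn nt)).
  rewrite (nse (SP n) s) ?nth_h ?phiG//.
  rewrite map_h -[stG (S n)]/((stG \o S) n) -mkseqS; apply/mapP; exists t => //.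
  by rewrite mem_iota.
have dy s m d : (s <= m)%N -> d \in stage_duals (hist m) -> d (y s m) = G s d.
  by move=> sm dm; rewrite /y sm (nsy (SP m) s dm) nth_h.
have fy j s m : (j < m)%N -> f j (y s m) = G s (f j).
  move=> jm; have [sm|ms] := leqP s m; first by apply: dy => //; exact: mem_f.
  rewrite /y leqNgt ms /= dual_eval0; apply/esym/(nsG0 (SP s)).
  by apply: mem_f; exact: ltn_trans ms.
exists y, e; split=> //.
- move=> s m; rewrite /y; case: ifPn => [sm|_]; last by rewrite normr0 ltW ?half_gt0.
  (* One half of [2^-s] pays for the norm of [G s], the other for the excess in Helly's theorem. *)
  rewrite [leRHS](_ : _ = half ^+ s.+1 + half ^+ s.+1); last first.
    by rewrite exprS; field.
  apply: le_trans (nsyb (SP m) s) _; rewrite nth_h// lerD2r.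
  by have := nsG (SP s); rewrite size_h.
- move=> s n t m sn; have [tm|mt] := leqP t m; last first.
    rewrite /y leqNgt mt /= dual_eval0; case: eqP => //= st.
    by rewrite ltnNge (leq_trans (ltnW mt)) ?mulr0n// -st.
  (* The later choice adapts to the earlier one: for [n < m] the point [y t m] acts on [e s n] like
     [G t]; for [m <= n] the functional [e s n] acts on [y t m] like [phi s], which vanishes on
     [X]. *)
  have [nm|mn] := ltnP n m.
    by rewrite andbT dy// ?Ge//; exact: mem_e.
  have xm : sty (S m) t \in stage_points (hist n) (sty (S n)).
    rewrite !mem_cat; apply/orP; right; apply/orP.
    move: mn; rewrite leq_eqVlt => /predU1P[mn|mn].
      right; rewrite mn; apply/mapP; exists t => //.
      by rewrite mem_iota size_h /= add0n ltnS -mn.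
    left; apply: (mem_h _ (fun st => [seq sty st s | s <- iota 0 (size (hist n)).+1]) n m) => //.
    apply/mapP; exists t => //; rewrite mem_iota size_h /=.
    by rewrite add0n ltnS (leq_trans tm)// ltnW.
  rewrite andbF /y tm /e (nse0 (SP n) s xm) nth_h//.
  exact: nsphi0 (SP s) _.
- move=> s; exists (`|phi s| + 1) => n sn.
  by have := nseb (SP n) s; rewrite nth_h.
- move=> s x r r0.
  have L0 : 0 < `|phi s| + 1 by rewrite ltr_wpDl.
  have [i xi] := vd x _ (divr_gt0 r0 L0).
  exists (maxn i.+1 s) => n; rewrite geq_max => /andP[ni sn].
  (* For [i < n] the functional [e s n] agrees at [v i] with [phi s], that is, vanishes. *)
  have -> : e s n x = e s n (x - v i).
    rewrite dual_evalB /e (nse0 (SP n) s (x := v i)) ?nth_h ?(nsphi0 (SP s)) ?subr0//.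
    by rewrite mem_cat map_f// mem_iota size_h.
  apply: (le_lt_trans (ler_dual_eval _ _)).
  have en : `|e s n| <= `|phi s| + 1 by have := nseb (SP n) s; rewrite nth_h.
  apply: (le_lt_trans (ler_wpM2r (normr_ge0 _) en)).
  by rewrite mulrC -ltr_pdivlMr.
- by move=> j s m m' jm jm'; rewrite !fy.
- move=> j s m js; have [jm|mj] := ltnP j m.
    by rewrite fy//; apply: (nsG0 (SP s)); exact: mem_f.
  by rewrite /y leqNgt (leq_ltn_trans mj js) dual_eval0.
Qed.

End weak_system.

Lemma exists_weak_system (R : realType) (cplx : bool)
    (X : completeNormedModType (scalars R cplx)) :
  separable X -> ~ quasireflexive X ->
  exists y e f, @weak_system R cplx X y e f.
Proof.
move=> sepX nqr; have [v vd] := separable_dense_seq sepX.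
have [f [f1 fd]] := exists_weak_star_dense_ball sepX.
have [y [e yef]] := exists_weak_system_aux nqr vd f1 fd.
by exists y, e, f.
Qed.

(** * Weak* closures and limits along ultrafilters *)

Section weak_star_closure.
Variables (R : realType) (cplx : bool).
Local Notation K := (scalars R cplx).
Variable X : normedModType K.
Implicit Types (B : set (dual X)) (f g h : dual X) (x : X).

Lemma ultrafilter_limit_real (T : Type) (F : set_system T) (u : T -> R) (C : R) :
  UltraFilter F -> F [set t | `|u t| <= C] ->
  exists l, forall r, 0 < r -> F [set t | `|u t - l| < r].
Proof.
move=> UF FC; have FC' : F (u @^-1` `[- C, C]%classic).
  by apply: filterS FC => t /=; rewrite in_itv /= ler_norml.
have [l [_ lF]] := @segment_compact R (- C) C (u @ F) _ FC'.
exists l => r r0.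
have [//|nF] := in_ultra_setVsetC [set t | `|u t - l| < r] UF.
have [z [/= zr]] := lF [set z | ~ `|z - l| < r] (ball l r) nF (nbhsx_ballx _ _ r0).
by rewrite -ball_normE /= distrC.
Qed.

Lemma ultrafilter_limit (T : Type) (F : set_system T) (u : T -> K) (C : K) :
  UltraFilter F -> F [set t | `|u t| <= C] ->
  exists l, forall r, 0 < r -> F [set t | `|u t - l| < r].
Proof.
move=> UF; case: cplx u C => /= u C FC; last exact: ultrafilter_limit_real FC.
have nC (a : R[i]) : `|a| <= C ->
    `|complex.Re a| <= complex.Re C /\ `|complex.Im a| <= complex.Re C.
  rewrite normc_def lecE /= => /andP[_ aC].
  split; apply: le_trans aC; rewrite -sqrtr_sqr ler_wsqrtr//.
    by rewrite lerDl sqr_ge0.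
  by rewrite lerDr sqr_ge0.
have [|l1 l1P] := @ultrafilter_limit_real _ F (fun t => complex.Re (u t)) (complex.Re C) UF.
  by apply: filterS FC => t /= /nC[].
have [|l2 l2P] := @ultrafilter_limit_real _ F (fun t => complex.Im (u t)) (complex.Re C) UF.
  by apply: filterS FC => t /= /nC[].
exists (l1 +i* l2)%C => -[r r']; rewrite ltcE /= => /andP[/eqP ir r0]; subst r'.
have r20 : 0 < r / 2 by rewrite divr_gt0.
apply: filterS2 (l1P _ r20) (l2P _ r20) => t /=.
case: (u t) => a b /= al bl.
exact: normc_lt.
Qed.

Lemma weak_star_cvgP (F : set_system (dual X)) g : Filter F ->
  (F --> (g : weak_star X)) <->
  (forall x (r : K), 0 < r -> F [set h : dual X | `|h x - g x| < r]).
Proof.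
move=> FF; split=> [Fg x r r0|Fg].
  have ptw : {ptws, (@dual_val R cplx X @ F) --> (g : X -> K^o)}.
    apply: cvg_trans (@initial_continuous _ _ (@dual_val R cplx X : _ -> {ptws X -> K^o}) g).
    exact: cvg_app.
  move/pointwise_cvgP : ptw => /(_ x)/cvgrPdist_lt/(_ r r0) H.
  have H' : F [set h : dual X | `|g x - h x| < r] by exact: H.
  by apply: filterS H' => h /=; rewrite distrC.
have ptw : {ptws, (@dual_val R cplx X @ F) --> (g : X -> K^o)}.
  apply/pointwise_cvgP => x; apply/cvgrPdist_lt => r r0.
  have H : F [set h : dual X | `|g x - h x| < r].
    by apply: filterS (Fg x r r0) => h /=; rewrite distrC.
  exact: H.
move=> A [_ [[C Co <-] Cg CA]].
by apply: filterS CA _; apply: ptw; exact: open_nbhs_nbhs.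
Qed.

(** An ultrafilter is used so that further bounded families indexed by the functionals in [B] also
    converge along it. *)
Lemma weak_star_closure_ultrafilter B g : weak_star_closure B g ->
  exists F : set_system (dual X), [/\ UltraFilter F, F B &
    forall x (r : K), 0 < r -> F [set h : dual X | `|h x - g x| < r]].
Proof.
move=> Bg; pose G : set_system (dual X) := within B (nbhs (g : weak_star X)).
have GF : ProperFilter G.
  apply: Build_ProperFilter_ex => A GA.
  by have [h [Bh Ah]] := Bg _ GA; exists h; exact: Ah.
have [F [UF GsubF]] := ultraFilterLemma GF; exists F; split=> //.
  by apply: GsubF; exact: withinT.
apply/weak_star_cvgP => A /= nA; apply: GsubF.
by apply: filterS nA.
Qed.

Lemma weak_star_closureI B g :
  (forall (l : seq X) (r : K), 0 < r ->
    exists2 h, B h & forall x, x \in l -> `|h x - g x| < r) ->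
  weak_star_closure B g.
Proof.
move=> approx A nA.
pose F : set_system (dual X) := filter_from [set lr : seq X * K | 0 < lr.2]
  (fun lr => B `&` [set h : dual X | forall x, x \in lr.1 -> `|h x - g x| < lr.2]).
have FF : ProperFilter F.
  apply: filter_from_proper; last first.
    by move=> [l r] /= r0; have [h Bh hl] := approx l r r0; exists h.
  apply: filter_from_filter; first by exists ([::], 1) => /=.
  move=> [l1 r1] [l2 r2] /= r10 r20.
  have [r12|r21] := real_leP (gtr0_real r10) (gtr0_real r20).
    exists (l1 ++ l2, r1) => //= h [Bh /= hl]; split; split=> //= x xl.
      by apply: hl; rewrite mem_cat xl.
    by apply: (lt_le_trans _ r12); apply: hl; rewrite mem_cat xl orbT.
  exists (l1 ++ l2, r2) => //= h [Bh /= hl]; split; split=> //= x xl.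
    by apply: (lt_trans _ r21); apply: hl; rewrite mem_cat xl.
  by apply: hl; rewrite mem_cat xl orbT.
have Fg : F --> (g : weak_star X).
  apply/weak_star_cvgP => x r r0; exists ([:: x], r) => // h [_ /=]; apply.
  by rewrite mem_seq1.
apply: (@filter_ex _ F); apply: filterI; last exact: Fg.
by exists ([::], 1) => //= h [].
Qed.

(* Banach-Alaoglu, for a family of functionals [b] indexed by an ultrafilter. *)
Lemma ultrafilter_limit_dual (T : Type) (F : set_system T) (b : T -> dual X) :
  UltraFilter F -> (forall t, `|b t| <= 1) ->
  exists2 b0 : dual X, `|b0| <= 1 &
    forall x (r : K), 0 < r -> F [set t | `|b t x - b0 x| < r].
Proof.
move=> UF b1.
have bx t x : `|b t x| <= `|x|.
  by apply: (le_trans (ler_dual_eval _ _)); apply: ler_piMl.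
have /choice[phi phiP] : forall x, exists l : K,
    forall r, 0 < r -> F [set t | `|b t x - l| < r].
  move=> x; apply: (ultrafilter_limit (C := `|x|)) => //.
  by apply: filterE => t /=; exact: bx.
have phi_cvg x : (fun t => b t x : K^o) @ F --> (phi x : K^o).
  apply/cvgrPdist_lt => r r0.
  by apply: filterS (phiP x r r0) => t /=; rewrite distrC.
have [||x|b0 b0E b01] := @dual_of_linear R cplx X phi 1.
- move=> a x y; apply: cvg_unique (phi_cvg _) _ => //.
  rewrite (_ : (fun t => _) = (fun t => a *: (b t x : K^o) + b t y)); last first.
    by apply/funext => t; exact: dual_linear.
  by apply: cvgD; [apply: cvgZl_tmp; exact: phi_cvg|exact: phi_cvg].
- exact: ler01.
- rewrite mul1r; apply/ler_addgt0Pr => r r0.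
  have [t /= tr] := filter_ex (phiP x r r0).
  rewrite -[phi x](subrK (b t x)) addrC; apply: (le_trans (ler_normD _ _)).
  by apply: lerD => //; rewrite distrC ltW.
exists b0 => // x r r0.
by have := phiP x r r0; rewrite -b0E.
Qed.

End weak_star_closure.

(** * Envelopes *)

Section envelope.
Variables (R : realType) (cplx : bool).
Local Notation K := (scalars R cplx).
Variable X : normedModType K.
Implicit Types (U B : set (dual X)) (f g h : dual X).

Lemma bounded_setP B : bounded_set B <-> exists C : K, forall f, B f -> `|f| <= C.
Proof.
split=> [/pinfty_ex_gt0[C C0 BC]|[C BC]]; first by exists C.
have [[f0 Bf0]|B0] := pselect (B !=set0).
  have Cr : C \is Num.real by apply: ger0_real; apply: le_trans (BC _ Bf0).
  by exists C; split=> // r Cr' f Bf; apply: (le_trans (BC f Bf)); exact: ltW.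
exists 0; split=> [|r _ f Bf]; first exact: real0.
by exfalso; apply: B0; exists f.
Qed.

Lemma weak_star_closure_approx B g : weak_star_closure B g ->
  forall (l : seq X) (r : K), 0 < r ->
    exists2 h, B h & forall x, x \in l -> `|h x - g x| < r.
Proof.
move=> /weak_star_closure_ultrafilter[F [UF FB Fg]] l r r0.
have : F (B `&` [set h : dual X | forall x, x \in l -> `|h x - g x| < r]).
  apply: filterI => //; elim: l => [|x l IH]; first by apply: filterE => h x.
  apply: filterS2 (Fg x r r0) IH => h /= hx hl z.
  by rewrite inE => /predU1P[->|/hl].
by move=> /filter_ex[h [Bh hl]]; exists h.
Qed.

Lemma weak_star_closure_shift B b g : weak_star_closure B g ->
  weak_star_closure [set h + b | h in B] (g + b).
Proof.
move=> Bg; apply: weak_star_closureI => l r r0.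
have [h Bh hl] := weak_star_closure_approx Bg l r0.
exists (h + b); first by exists h.
by move=> x /hl; rewrite (_ : (h + b) x - (g + b) x = h x - g x)// !dualDE; ring.
Qed.

Lemma weak_star_closure_ball B (C : K) g : (forall f, B f -> `|f| <= C) ->
  weak_star_closure B g -> `|g| <= C.
Proof.
move=> BC Bg.
have [h0 Bh0 _] := weak_star_closure_approx Bg [::] ltr01.
have C0 : 0 <= C := le_trans (normr_ge0 _) (BC _ Bh0).
apply: dual_norm_le => // x x1; apply/ler_addgt0Pr => r r0.
have [h Bh /(_ x (mem_head _ _)) hx] := weak_star_closure_approx Bg [:: x] r0.
rewrite -[g x](subrK (h x)) addrC; apply: (le_trans (ler_normD _ _)).
apply: lerD; last by rewrite distrC ltW.
apply: (le_trans (ler_dual_eval h x)); apply: le_trans (BC _ Bh).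
by apply: ler_piMr.
Qed.

Lemma envelopeS U U' : U `<=` U' -> envelope U `<=` envelope U'.
Proof.
move=> UU' f [B [BU Bb [d d0 Bd]] Bf]; exists B => //; split=> //.
  exact: subset_trans BU UU'.
by exists d => // h g Bh nUg; apply: Bd => // /UU'.
Qed.

Lemma open_ballP U : (forall f, U f ->
  exists2 d : K, 0 < d & forall g, `|f - g| < d -> U g) -> open U.
Proof.
move=> Uball; rewrite openE => f /Uball[d d0 Ud].
apply/nbhs_ballP; exists d => // g; rewrite -ball_normE /=; exact: Ud.
Qed.

Lemma sub_envelope U : open U -> U `<=` envelope U.
Proof.
rewrite openE => oU f Uf; have /nbhs_ballP[d /= d0 fd] := oU f Uf.
exists [set f]; last first.
  by apply: weak_star_closureI => l r r0; exists f => // x _; rewrite subrr normr0.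
split=> [_ ->//||].
  by apply/bounded_setP; exists `|f| => _ ->.
exists d => // _ g -> nUg.
have [//|fg] := real_leP (gtr0_real d0) (normr_real (f - g)).
by exfalso; apply: nUg; apply: fd; rewrite -ball_normE.
Qed.

Lemma Ubounded_shift U B (d : K) b : B `<=` U -> bounded_set B ->
  (forall f g, B f -> ~ U g -> d <= `|f - g|) -> `|b| < d ->
  Ubounded U [set h + b | h in B].
Proof.
move=> BU /bounded_setP[C BC] Bd bd; split.
- move=> _ [h Bh <-]; apply: contrapT => nU.
  by have := Bd _ _ Bh nU; rewrite opprD addNKr normrN (lt_geF bd).
- apply/bounded_setP; exists (C + `|b|) => _ [h Bh <-].
  by apply: (le_trans (ler_normD _ _)); rewrite lerD2r BC.
- exists (d - `|b|); first by rewrite subr_gt0.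
  move=> _ g [h Bh <-] nUg; rewrite lerBlDr.
  apply: (le_trans (Bd _ _ Bh nUg)).
  rewrite (_ : h - g = (h + b - g) - b); first exact: ler_normB.
  by rewrite addrAC addrK.
Qed.

Lemma open_envelope U : open (envelope U).
Proof.
apply: open_ballP => f [B [BU Bb [d d0 Bd]] Bf]; exists d => // g fg.
exists [set h + (g - f) | h in B].
  by apply: Ubounded_shift Bd _ => //; rewrite distrC.
by have := weak_star_closure_shift (b := g - f) Bf; rewrite (addrC f) subrK.
Qed.

(** * Transfinite induction along iterated envelopes *)

Section iterated.
Variables (d : Order.disp_t) (T : orderType d).
Hypothesis wfT : well_founded (fun s t : T => (s < t)%O).
Local Notation iter := (iter_envelope wfT).

Lemma ordinal_cases (t : T) : [\/ is_zero t, exists s, is_succ s t | is_limit t].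
Proof.
have [t0|t0] := pselect (is_zero t); first exact: Or31.
have [ts|ts] := pselect (exists s, is_succ s t); first exact: Or32.
by apply: Or33; split.
Qed.

Lemma nzero_lt (t : T) : ~ is_zero t -> exists s, (s < t)%O.
Proof.
move=> t0; apply: contrapT => nt; apply: t0 => s.
by rewrite leNgt; apply/negP => st; apply: nt; exists s.
Qed.

Lemma limit_dense (s t : T) : is_limit t -> (s < t)%O ->
  exists2 r, (s < r)%O & (r < t)%O.
Proof.
move=> [_ nsucc] st; apply: contrapT => nr; apply: nsucc; exists s; split=> // r rt.
by rewrite leNgt; apply/negP => sr; apply: nr; exists r.
Qed.

Lemma iter_envelope_sub U (V : T -> set (dual X)) :
  (forall t, is_zero t -> U `<=` V t) ->
  (forall s t, is_succ s t -> envelope (V s) `<=` V t) ->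
  (forall s t, (s < t)%O -> V s `<=` V t) ->
  forall t, iter U t `<=` V t.
Proof.
move=> V0 VS Vlim t; elim/(well_founded_ind wfT) : t => t IH.
have [t0|[s st]|tl] := ordinal_cases t.
- by rewrite iter_envelope0//; exact: V0.
- rewrite (iter_envelopeS wfT U st); apply: subset_trans (VS _ _ st).
  by apply: envelopeS; apply: IH; exact: st.1.
- rewrite iter_envelope_lim// => f [s /= st /(IH s st)]; exact: Vlim.
Qed.

Lemma sub_iter_envelope U (V : T -> set (dual X)) :
  (forall t, is_zero t -> V t `<=` U) ->
  (forall s t, is_succ s t -> V t `<=` envelope (V s)) ->
  (forall t, is_limit t -> V t `<=` \bigcup_(s in [set s | (s < t)%O]) V s) ->
  forall t, V t `<=` iter U t.
Proof.
move=> V0 VS Vlim t; elim/(well_founded_ind wfT) : t => t IH.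
have [t0|[s st]|tl] := ordinal_cases t.
- by rewrite iter_envelope0//; exact: V0.
- rewrite (iter_envelopeS wfT U st); apply: subset_trans (VS _ _ st) _.
  by apply: envelopeS; apply: IH; exact: st.1.
- rewrite iter_envelope_lim// => f /(Vlim t tl)[s /= st Vf].
  by exists s => //; exact: IH Vf.
Qed.

Lemma open_iter_envelope U t : open U -> open (iter U t).
Proof.
move=> oU; elim/(well_founded_ind wfT) : t => t IH.
have [t0|[s st]|tl] := ordinal_cases t.
- by rewrite iter_envelope0.
- by rewrite (iter_envelopeS wfT U st); exact: open_envelope.
- by rewrite iter_envelope_lim//; apply: bigcup_open => s; exact: IH.
Qed.

Lemma sub_iter_envelope0 U t : open U -> U `<=` iter U t.
Proof.
move=> oU; apply: (@sub_iter_envelope U (fun=> U)); first by move=> ? _ f.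
  by move=> ? ? _; exact: sub_envelope.
by move=> r [/nzero_lt[s sr] _] f Uf; exists s.
Qed.

(** The constant family [iter U t] satisfies the hypotheses of [iter_envelope_sub] as soon as it
    absorbs its own envelope; so even the later iterates stay inside. *)
Lemma iter_envelope_stable U t : open U -> envelope (iter U t) `<=` iter U t ->
  forall s, iter U s `<=` iter U t.
Proof.
move=> oU stab; apply: (@iter_envelope_sub U (fun=> iter U t)).
- by move=> ? _; exact: sub_iter_envelope0.
- by [].
- by move=> ? ? _ f.
Qed.

End iterated.
End envelope.

(** * The tree of constraints *)

Section tree.

(* The vertices of the tree are the natural numbers, with root 0; every
   positive number is the [n]-th child of [s] for a unique pair [(s, n)]. *)
Definition tree_child (s n : nat) : nat := (2 ^ s * n.*2.+1)%N.

Definition tree_parent (t : nat) : nat := logn 2 t.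

Definition tree_index (t : nat) : nat := ((t %/ 2 ^ logn 2 t)./2)%N.

Lemma tree_childK s n : tree_parent (tree_child s n) = s.
Proof.
rewrite /tree_parent /tree_child lognM ?expn_gt0// pfactorK//.
rewrite (_ : logn 2 _ = 0%N) ?addn0//.
by rewrite lognE dvdn2 /= odd_double.
Qed.

Lemma tree_indexK s n : tree_index (tree_child s n) = n.
Proof.
rewrite /tree_index -/(tree_parent _) tree_childK /tree_child mulKn ?expn_gt0//.
by rewrite -uphalfE uphalf_double.
Qed.

Lemma tree_child_gt0 s n : (0 < tree_child s n)%N.
Proof. by rewrite muln_gt0 expn_gt0. Qed.

Lemma leq_tree_child s n : (n <= tree_child s n)%N.
Proof.
apply: leq_trans (leq_pmull _ _); last by rewrite expn_gt0.
by rewrite -addnn -addSn leq_addl.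
Qed.

Lemma ltn_tree_child s n N : (s < N)%N -> (n < N)%N ->
  (tree_child s n < tree_child N N)%N.
Proof.
move=> sN nN; apply: (@leq_ltn_trans (2 ^ N * n.*2.+1)).
  by rewrite leq_mul2r leq_pexp2l ?orbT// ltnW.
by rewrite ltn_pmul2l ?expn_gt0// ltnS ltn_double.
Qed.

Variables (d : Order.disp_t) (T : orderType d).
Implicit Types (rho sigma : T).

Lemma countable_cofinal rho : countable [set s : T | (s < rho)%O] ->
  exists c : nat -> option T,
    (forall k sigma, c k = Some sigma -> (sigma < rho)%O) /\
    (forall b, (b < rho)%O -> exists k0, forall k, (k0 <= k)%N ->
      exists2 sigma, c k = Some sigma & (b <= sigma)%O).
Proof.
rewrite /countable => /pcard_leP[g].
have [[s0 s0rho]|empty] := pselect (exists s : T, (s < rho)%O); last first.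
  by exists (fun=> None); split=> // b brho; exfalso; apply: empty; exists b.
have ginj s t : (s < rho)%O -> (t < rho)%O -> g s = g t -> s = t.
  by move=> sr tr; apply: (@inj _ _ _ g); exact/mem_set.
have /choice[c cP] : forall k, exists sigma, (sigma < rho)%O /\
    forall t, (t < rho)%O -> (g t < k)%N -> (t <= sigma)%O.
  elim=> [|k [s [sr sk]]]; first by exists s0.
  have [[u [ur uk]]|nu] := pselect (exists u : T, (u < rho)%O /\ g u = k).
    exists (Order.max s u); split; first by rewrite gt_max sr.
    move=> t tr; rewrite ltnS leq_eqVlt => /predU1P[gt|gt].
      by rewrite (ginj t u) ?le_max ?lexx ?orbT// gt.
    by rewrite le_max sk.
  exists s; split=> // t tr; rewrite ltnS leq_eqVlt => /predU1P[gt|]; last exact: sk.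
  by exfalso; apply: nu; exists t.
exists (fun k => Some (c k)); split=> [k _ [<-]|b br]; first exact: (cP k).1.
exists (g b).+1 => k gk; exists (c k) => //.
by apply: (cP k).2.
Qed.

Variables (alpha : T) (child : T -> nat -> option T).
Hypothesis child_lt : forall rho k sigma, child rho k = Some sigma -> (sigma < rho)%O.
Hypothesis child_cofinal : forall rho b, (rho <= alpha)%O -> (b < rho)%O ->
  exists k0, forall k, (k0 <= k)%N ->
    exists2 sigma, child rho k = Some sigma & (b <= sigma)%O.

(** A number is a vertex if it carries a rank: where [child rho n] is [None] the [n]-th child is
    missing, and so are all its descendants. *)
Inductive ranked : nat -> T -> Prop :=
| ranked_root : ranked 0 alpha
| ranked_child s n rho sigma : ranked s rho -> child rho n = Some sigma ->
    ranked (tree_child s n) sigma.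

Lemma ranked_inv t rho : ranked t rho ->
  (t = 0%N /\ rho = alpha) \/
  exists s n rho', [/\ t = tree_child s n, ranked s rho' & child rho' n = Some rho].
Proof. by case=> [|s n r r' sr cr]; [left|right; exists s, n, r]. Qed.

Lemma ranked_child_inv s n sigma : ranked (tree_child s n) sigma ->
  exists2 rho, ranked s rho & child rho n = Some sigma.
Proof.
move=> /ranked_inv[[t0 _]|[s' [n' [rho [tE sr cr]]]]].
  by have := tree_child_gt0 s n; rewrite t0.
exists rho.
  by rewrite -(tree_childK s n) tE tree_childK.
by rewrite -(tree_indexK s n) tE tree_indexK.
Qed.

Lemma ranked_uniq t rho rho' : ranked t rho -> ranked t rho' -> rho = rho'.
Proof.
move=> tr; elim: tr rho' => {t rho} [|s n rho sigma sr IH cr] rho' => [/ranked_inv|].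
  case=> [[]//|[s [n [r [t0 _ _]]]]].
  by have := tree_child_gt0 s n; rewrite -t0.
move=> /ranked_child_inv[r /IH <-]; rewrite cr => -[]//.
Qed.

Lemma ranked_le t rho : ranked t rho -> (rho <= alpha)%O.
Proof.
elim=> {t rho} [//|s n rho sigma sr IH /child_lt cr].
exact: le_trans (ltW cr) IH.
Qed.

Lemma ranked_top t rho : ranked t rho -> (alpha <= rho)%O -> t = 0%N.
Proof.
move=> /ranked_inv[[]//|[s [n [r [_ sr /child_lt cr]]]]].
by rewrite leNgt (lt_le_trans cr (ranked_le sr)).
Qed.

Section constraints.
Variables (R : realType) (cplx : bool).
Local Notation K := (scalars R cplx).
Local Notation half := (2^-1 : K).
Variable X : normedModType K.
Variables (y : nat -> nat -> X) (e : nat -> nat -> dual X) (f : nat -> dual X).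
Hypothesis yef : weak_system y e f.
Implicit Types (a b g h w : dual X).

Definition vertex_point (t : nat) : X :=
  if t == 0%N then 0
  else y (tree_parent t) (tree_index t).+1 - y (tree_parent t) (tree_index t).

Local Notation x := vertex_point.

Lemma vertex_point_child s n : x (tree_child s n) = y s n.+1 - y s n.
Proof. by rewrite /x gtn_eqF ?tree_child_gt0// tree_childK tree_indexK. Qed.

Definition balanced (t : nat) : set (dual X) := [set a | forall r : K, 0 < r ->
  exists m0, forall m, (m0 <= m)%N -> `|a (x t) - a (y t m)| < r].

Definition balanced_from (b : T) : set (dual X) :=
  [set a | forall t rho, ranked t rho -> (b <= rho)%O -> balanced t a].

Lemma balanced_linear t (c : K) a b : balanced t a -> balanced t b -> balanced t (c *: a + b).
Proof.
move=> ta tb r r0.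
have c0 : 0 < `|c| + 1 by rewrite ltr_wpDl.
have r20 : 0 < r / 2 by rewrite divr_gt0.
have [m1 am] := ta _ (divr_gt0 r20 c0).
have [m2 bm] := tb _ r20.
exists (maxn m1 m2) => m; rewrite geq_max => /andP[/am am' /bm bm'].
have -> : (c *: a + b) (x t) - (c *: a + b) (y t m) =
    c * (a (x t) - a (y t m)) + (b (x t) - b (y t m)).
  change (c * a (x t) + b (x t) - (c * a (y t m) + b (y t m)) =
    c * (a (x t) - a (y t m)) + (b (x t) - b (y t m))); ring.
apply: (le_lt_trans (ler_normD _ _)); rewrite [ltRHS]splitr; apply: ltrD => //.
rewrite normrM; apply: le_lt_trans (_ : (`|c| + 1) * `|a (x t) - a (y t m)| < _).
  by apply: ler_wpM2r; rewrite ?normr_ge0// lerDl ler01.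
by rewrite mulrC -ltr_pdivlMr.
Qed.

Lemma balanced0 t : balanced t 0.
Proof. by move=> r r0; exists 0%N => m _; rewrite subrr normr0. Qed.

(** * The starting set, and the constraints that survive envelopes *)

Definition start_set : set (dual X) :=
  [set g | exists a b, [/\ g = a + b, (forall t rho, ranked t rho -> balanced t a) & `|b| < 1]].

(** The closed ball replaces the open one because the perturbations [b] are passed to weak*
    limits. *)
Definition upper_set (s : T) : set (dual X) :=
  [set g | exists a b, [/\ g = a + b, balanced_from s a & `|b| <= 1]].

(** [a (x t)] is the limit of the [a (y t m)], and [|y t m| <= 2^-t]. Applied at the children of
    [s], this makes the increments of [a (y s m)] summable. *)
Lemma balanced_le t a : balanced t a -> `|a (x t)| <= half ^+ t * `|a|.
Proof.
move=> ta; apply/ler_addgt0Pr => r /ta[m /(_ m (leqnn _)) am].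
rewrite -[a (x t)](subrK (a (y t m))) addrC; apply: (le_trans (ler_normD _ _)).
apply: lerD; last exact: ltW.
apply: (le_trans (ler_dual_eval _ _)); rewrite mulrC.
by apply: ler_wpM2r; [exact: normr_ge0|exact: ws_norm yef _ _].
Qed.

Lemma half_le m n : (m <= n)%N -> half ^+ n <= half ^+ m.
Proof.
move=> mn; apply: ler_wiXn2l => //.
by rewrite invf_le1 ?ltr0n// ler1n.
Qed.

(* If the children of [s] are balanced from rank [k0] on, then the
   approximation of [a (x s)] by [a (y s m)] has an explicit rate, which
   survives weak* limits of bounded sets. *)
Lemma balanced_rate s k0 a (D : K) : `|a| <= D -> balanced s a ->
  (forall n, (k0 <= n)%N -> balanced (tree_child s n) a) ->
  forall m, (k0 <= m)%N -> `|a (x s) - a (y s m)| <= D * 2 * half ^+ m.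
Proof.
move=> aD sa ca m km.
(* Telescoping over children: the child with index [m + j] has a number at least [m + j], so its
   increment is at most [2^-(m + j) * D]. *)
have step j : `|a (y s (m + j)) - a (y s m)| <= D * 2 * (half ^+ m - half ^+ (m + j)).
  elim: j => [|j IH]; first by rewrite addn0 !subrr normr0 mulr0.
  have -> : a (y s (m + j.+1)) - a (y s m) =
      a (x (tree_child s (m + j))) + (a (y s (m + j)) - a (y s m)).
    by rewrite vertex_point_child dual_evalB addnS; ring.
  apply: (le_trans (ler_normD _ _)).
  have -> : D * 2 * (half ^+ m - half ^+ (m + j.+1)) =
      half ^+ (m + j) * D + D * 2 * (half ^+ m - half ^+ (m + j)).
    by rewrite addnS exprS; field.
  apply: lerD => //.
  apply: (le_trans (balanced_le (ca _ (leq_trans km (leq_addr _ _))))).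
  apply: ler_pM (normr_ge0 _) _ aD; first exact/ltW/half_gt0.
  by apply: half_le; exact: leq_tree_child.
apply/ler_addgt0Pr => r /sa[m1 sm].
pose j := m1.
rewrite -(subrKA (a (y s (m + j)))); apply: (le_trans (ler_normD _ _)).
rewrite addrC; apply: lerD; last by apply: ltW; apply: sm; exact: leq_addl.
apply: (le_trans (step j)); apply: ler_wpM2l.
  by apply: mulr_ge0; [exact: le_trans aD|exact: ler0n].
by rewrite gerBl ltW ?half_gt0.
Qed.

Lemma envelope_upper_set s t : is_succ s t -> envelope (upper_set s) `<=` upper_set t.
Proof.
move=> [st _] g [B [BV /bounded_setP[C BC] _]].
move=> /weak_star_closure_ultrafilter[F [UF FB Fg]].
(* A part [b h] in the unit ball is split off from each [h]; these parts converge to some [b0] along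
   the ultrafilter, so [g - b0] is the weak* limit of the balanced parts. *)
have /choice[b bP] : forall h, exists b, `|b| <= 1 /\ (B h -> balanced_from s (h - b)).
  move=> h; have [/BV[a [b [-> sa b1]]]|nB] := pselect (B h).
    by exists b; split=> // _; rewrite addrK.
  by exists 0; rewrite normr0 ler01.
have [b0 b01 b0F] := ultrafilter_limit_dual UF (fun h => (bP h).1).
exists (g - b0), b0; split=> //; first by rewrite subrK.
move=> u rho ur trho.
(* As [s < rho], the children of [u] have rank at least [s] from an index [k0] on that does not
   depend on [h]; their constraints hold for every [h - b h] with [h] in [B]. *)
have srho : (s < rho)%O by exact: lt_le_trans trho.
have [k0 k0P] := child_cofinal (ranked_le ur) srho.
have rate m : (k0 <= m)%N ->
    `|(g - b0) (x u) - (g - b0) (y u m)| <= (C + 1) * 2 * half ^+ m.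
  move=> km; apply/ler_addgt0Pr => r r0.
  have r40 : 0 < r / 4 by rewrite divr_gt0.
  have /filter_ex[h [Bh [[h1 h2] [h3 h4]]]] : F (B `&`
      (([set h : dual X | `|h (x u) - g (x u)| < r / 4] `&`
        [set h : dual X | `|h (y u m) - g (y u m)| < r / 4]) `&`
       ([set h : dual X | `|b h (x u) - b0 (x u)| < r / 4] `&`
        [set h : dual X | `|b h (y u m) - b0 (y u m)| < r / 4]))).
    apply: filterI => //; apply: filterI; apply: filterI.
    - exact: Fg.
    - exact: Fg.
    - exact: b0F.
    - exact: b0F.
  have hb : `|(h - b h) (x u) - (h - b h) (y u m)| <= (C + 1) * 2 * half ^+ m.
    have sa := (bP h).2 Bh; apply: balanced_rate km.
    - apply: (le_trans (ler_normB _ _)); apply: lerD; [exact: BC|exact: (bP h).1].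
    - by apply: (sa u rho ur); exact: ltW.
    - move=> n /k0P[sigma cs ssigma]; apply: sa ssigma.
      exact: ranked_child ur cs.
  pose E := (b h (x u) - b0 (x u)) - (h (x u) - g (x u))
    + (h (y u m) - g (y u m)) - (b h (y u m) - b0 (y u m)).
  have -> : (g - b0) (x u) - (g - b0) (y u m) =
      ((h - b h) (x u) - (h - b h) (y u m)) + E.
    change ((g (x u) - b0 (x u)) - (g (y u m) - b0 (y u m)) =
      (h (x u) - b h (x u)) - (h (y u m) - b h (y u m)) + E).
    by rewrite /E; ring.
  apply: (le_trans (ler_normD _ _)); apply: lerD => //.
  have -> : r = r / 4 + r / 4 + r / 4 + r / 4 by field.
  rewrite /E.
  apply: (le_trans (ler_normB _ _)); apply: lerD; last exact: ltW.
  apply: (le_trans (ler_normD _ _)); apply: lerD; last exact: ltW.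
  by apply: (le_trans (ler_normB _ _)); apply: lerD; exact: ltW.
have C10 : 0 <= C + 1.
  have [h [Bh _]] := filter_ex (filterI FB (filterT : F setT)).
  apply: (le_trans (normr_ge0 h)); apply: (le_trans (BC _ Bh)).
  by rewrite lerDl ler01.
have D0 : 0 < (C + 1) * 2 + 1.
  by rewrite ltr_wpDl// mulr_ge0 ?ler0n.
move=> r r0; have [n nr] := half_lt (divr_gt0 r0 D0).
exists (maxn k0 n) => m; rewrite geq_max => /andP[km nm].
apply: (le_lt_trans (rate m km)).
apply: (@le_lt_trans _ _ (((C + 1) * 2 + 1) * half ^+ n)); last first.
  by rewrite mulrC -ltr_pdivlMr.
apply: ler_pM; last exact: half_le.
- by rewrite mulr_ge0 ?ler0n.
- exact/ltW/half_gt0.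
- by rewrite lerDl ler01.
Qed.

(** * Finitely supported defects, and the constraints that envelopes destroy *)

Definition eventually_constant (N : nat) : set (dual X) :=
  [set w | (forall t m m', (N <= m)%N -> (N <= m')%N -> w (y t m) = w (y t m')) /\
           (forall t m, (N <= t)%N -> w (y t m) = 0)].

(** For [w] constant on the sequence [y t] from [N] on, the constraint at [t] becomes the single
    equation [defect N t w = 0]. *)
Definition defect (N t : nat) (w : dual X) : K := w (x t) - w (y t N).

Definition lower_set (b : T) : set (dual X) :=
  [set w | exists2 N, eventually_constant N w &
    forall t rho, ranked t rho -> (b <= rho)%O -> defect N t w = 0].

Definition lower_ball (b : T) : set (dual X) :=
  [set g | exists w v, [/\ g = w + v, lower_set b w & `|v| < 1]].

Lemma defectD N t w g : defect N t (w + g) = defect N t w + defect N t g.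
Proof. by rewrite /defect !dualDE; ring. Qed.

Lemma defectZ N t (c : K) w : defect N t (c *: w) = c * defect N t w.
Proof.
rewrite /defect; change (c * w (x t) - c * w (y t N) = c * (w (x t) - w (y t N))).
by rewrite mulrBr.
Qed.

Lemma eventually_constantW N N' w : (N <= N')%N ->
  eventually_constant N w -> eventually_constant N' w.
Proof.
move=> NN' [wc w0]; split=> [t m m' Nm Nm'|t m Nt].
  by apply: wc; exact: leq_trans NN' _.
by apply: w0; exact: leq_trans NN' _.
Qed.

Lemma eventually_constantD N w g : eventually_constant N w ->
  eventually_constant N g -> eventually_constant N (w + g).
Proof.
move=> [wc w0] [gc g0]; split=> [t m m' Nm Nm'|t m Nt]; rewrite !dualDE.
  by rewrite (wc t m m')// (gc t m m').
by rewrite w0// g0// addr0.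
Qed.

Lemma eventually_constantZ N (c : K) w : eventually_constant N w ->
  eventually_constant N (c *: w).
Proof.
move=> [wc w0]; split=> [t m m' Nm Nm'|t m Nt]; rewrite !dualZE.
  by rewrite (wc t m m').
by rewrite w0// scaler0.
Qed.

Lemma eventually_constant0 N : eventually_constant N 0.
Proof. by []. Qed.

Lemma eventually_constant_e u n : (u <= n)%N -> eventually_constant n.+1 (e u n).
Proof.
move=> un; split=> [t m m' nm nm'|t m nt]; rewrite !(ws_eval yef)//.
  by rewrite nm nm'.
by rewrite ltn_eqF//; exact: leq_ltn_trans nt.
Qed.

Lemma eventually_constant_f j : eventually_constant j.+1 (f j).
Proof.
split=> [t m m' jm jm'|t m jt]; first exact: (ws_stationary yef).
exact: (ws_vanish yef).
Qed.

Lemma defectW N N' t w : (N <= N')%N -> eventually_constant N w ->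
  defect N' t w = defect N t w.
Proof. by move=> NN' [wc _]; rewrite /defect (wc t N' N). Qed.

(** The defect at [u] is -1 because [e u n] is 1 on the far [y u N]; the excluded vertex is the one
    whose increment sees [e u n] jump from 0 to 1. *)
Lemma defect_e u n N t : (u <= n)%N -> (n < N)%N -> t <> tree_child u n ->
  (exists rho, ranked t rho) -> defect N t (e u n) = - (u == t)%:R.
Proof.
move=> un nN tun [rho /ranked_inv tP].
rewrite /defect (ws_eval yef)// nN andbT (_ : e u n (x t) = 0) ?sub0r//.
case: tP => [[-> _]|[s [k [rho' [tE _ _]]]]]; first exact: dual_eval0.
rewrite tE vertex_point_child dual_evalB !(ws_eval yef)//.
have [us|//] := eqVneq u s; last by rewrite subrr.
have nk : n <> k by move=> nk; apply: tun; rewrite tE us nk.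
rewrite /= ltnS leq_eqVlt; case: eqP => //= _.
by rewrite subrr.
Qed.

(** A vertex past [tree_child N N] has a number at least [N], and its parent or its index is at
    least [N] too; so [w] vanishes on its sequence and on its point. Thus only finitely many
    vertices can carry a defect. *)
Lemma eventually_constant_defect N w t rho : eventually_constant N w ->
  ranked t rho -> (tree_child N N <= t)%N -> defect N t w = 0.
Proof.
move=> [wc w0] /ranked_inv[[-> _]|[s [n [rho' [-> _ _]]]]].
  by rewrite leqNgt tree_child_gt0.
move=> Nt; rewrite /defect (w0 (tree_child s n)) ?subr0; last first.
  exact: leq_trans (leq_tree_child N N) Nt.
rewrite vertex_point_child dual_evalB.
have [Ns|sN] := leqP N s; first by rewrite !w0// subrr.
have [Nn|nN] := leqP N n; first by rewrite (wc s n.+1 n) ?subrr// leqW.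
by move: Nt; rewrite leqNgt ltn_tree_child.
Qed.

Lemma sum_e_bounded M (c : nat -> K) : exists L : K, forall n, (M <= n)%N ->
  `|\sum_(u < M) c u *: e u n| <= L.
Proof.
elim: M => [|M [L IH]]; first by exists 0 => n _; rewrite big_ord0 normr0.
have [L' eL'] := ws_bounded yef M.
exists (L + `|c M| * L') => n Mn; rewrite big_ord_recr /=.
apply: (le_trans (ler_normD _ _)); apply: lerD; first by apply: IH; exact: ltnW.
by rewrite normrZ; apply: ler_wpM2l; [exact: normr_ge0|apply: eL'; exact: ltnW].
Qed.

Lemma sum_e_null M (c : nat -> K) (l : seq X) (r : K) : 0 < r ->
  exists n0, forall n, (n0 <= n)%N -> forall z, z \in l ->
    `|(\sum_(u < M) c u *: e u n) z| < r.
Proof.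
move=> r0; elim: l => [|z l [n1 n1P]]; first by exists 0%N.
have [n2 n2P] : exists n0, forall n, (n0 <= n)%N ->
    `|(\sum_(u < M) c u *: e u n) z| < r.
  elim: M r r0 {n1 n1P} => [|M IH] r r0.
    by exists 0%N => n _; rewrite big_ord0 normr0.
  have r20 : 0 < r / 2 by rewrite divr_gt0.
  have [n1 n1P] := IH _ r20.
  have c0 : 0 < `|c M| + 1 by rewrite ltr_wpDl.
  have [n2 n2P] := ws_null yef M z (divr_gt0 r20 c0).
  exists (maxn n1 n2) => n; rewrite geq_max => /andP[/n1P nn1 /n2P nn2].
  rewrite big_ord_recr dualDE [r]splitr.
  apply: (le_lt_trans (ler_normD _ _)); apply: ltrD => //.
  rewrite dualZE normrM.
  apply: (@le_lt_trans _ _ ((`|c M| + 1) * `|e M n z|)).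
    by apply: ler_wpM2r; [exact: normr_ge0|rewrite lerDl ler01].
  by rewrite mulrC -ltr_pdivlMr.
exists (maxn n1 n2) => n; rewrite geq_max => /andP[nn1 nn2] w.
by rewrite inE => /predU1P[->|]; [exact: n2P|exact: n1P].
Qed.

Definition correction (b : T) N w (u : nat) : K :=
  if pselect (ranked u b) then defect N u w else 0.

(* [e u n] removes the defect at [u] and creates one at the [n]-th child of
   [u], which has a smaller rank. *)
Lemma corrected_lower_set (b : T) w N M n : eventually_constant N w -> (M <= n)%N ->
  (forall t rho, ranked t rho -> (b <= rho)%O ->
     defect N t w = 0 \/ (rho = b /\ (t < M)%N)) ->
  lower_set b (w + \sum_(u < M) correction b N w u *: e u n).
Proof.
move=> wN Mn wb; set c := correction b N w.
pose N' := maxn N n.+1.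
have NN' : (N <= N')%N by exact: leq_maxl.
have nN' : (n < N')%N by exact: leq_maxr.
have sumN' : eventually_constant N' (\sum_(u < M) c u *: e u n).
  apply: big_ind => [||u _].
  - exact: eventually_constant0.
  - by move=> g h; exact: eventually_constantD.
  - apply: eventually_constantZ; apply: eventually_constantW nN' _.
    by apply: eventually_constant_e; rewrite ltnW// (leq_trans _ Mn).
exists N'; first by apply: eventually_constantD => //; exact: eventually_constantW wN.
move=> t rho trho brho; rewrite defectD (defectW _ NN' wN).
have -> : defect N' t (\sum_(u < M) c u *: e u n) = - \sum_(u < M) c u * (u == t :> nat)%:R.
  rewrite (big_morph (defect N' t) (defectD N' t) (_ : defect N' t 0 = 0)); last first.
    by rewrite /defect subrr.
  rewrite -sumrN; apply: eq_bigr => u _; rewrite defectZ -mulrN /c /correction.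
  case: pselect => ub; last by rewrite !mul0r.
  congr (_ * _); apply: defect_e => //; first by rewrite ltnW// (leq_trans _ Mn).
    (* [t] cannot be the [n]-th child of [u], whose rank would be below [b]. *)
    move=> tE; move: trho; rewrite tE => /ranked_child_inv[rho' urho' /child_lt].
    by rewrite (ranked_uniq urho' ub) ltNge brho.
  by exists rho.
have [tM|Mt] := ltnP t M.
  rewrite (bigD1 (Ordinal tM))//= eqxx mulr1 big1 ?addr0 => [|u ut]; last first.
    by rewrite (negbTE (_ : u != t :> nat)) ?mulr0.
  have [w0|[rhob _]] := wb t rho trho brho.
    by rewrite w0 /c /correction; case: pselect => ?; rewrite ?w0 subrr.
  rewrite /c /correction; case: pselect => [?|]; first by rewrite subrr.
  by rewrite -rhob.
rewrite big1 ?subr0 => [|u _]; last first.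
  by rewrite ltn_eqF ?mulr0//; exact: leq_trans Mt.
have [//|[_]] := wb t rho trho brho.
by rewrite ltnNge Mt.
Qed.

(** [lower_set b] has distance at least 1 from the complement of [lower_ball b], so its bounded
    subsets may be translated by any [v] of norm less than 1. *)
Lemma envelope_lower_ball (b : T) (B : set (dual X)) w v : B `<=` lower_set b ->
  bounded_set B -> weak_star_closure B w -> `|v| < 1 ->
  envelope (lower_ball b) (w + v).
Proof.
move=> Bb bB Bw v1; exists [set h + v | h in B]; last exact: weak_star_closure_shift.
apply: Ubounded_shift bB _ v1 => [h Bh|h g Bh nbg].
  by exists h, 0; rewrite addr0 normr0; split=> //; exact: Bb.
have [//|hg] := real_leP (@real1 K) (normr_real (h - g)).
exfalso; apply: nbg; exists h, (g - h); split; last by rewrite distrC.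
  by rewrite addrC subrK.
exact: Bb.
Qed.

(** Only the finitely many vertices of rank [s] below [M] may need repair. The repaired functionals
    form a bounded family converging weak* to [w] as [n] grows, because the [e u n] are weak*
    null. *)
Lemma lower_ball_succ s t : is_succ s t -> lower_ball t `<=` envelope (lower_ball s).
Proof.
move=> [st smax] g [w [v [-> [N wN wt] v1]]].
pose M := tree_child N N; pose c := correction s N w.
pose B := [set w + \sum_(u < M) c u *: e u n | n in [set n | (M <= n)%N]].
apply: (@envelope_lower_ball s B) => //.
- move=> _ [n /= Mn <-]; apply: corrected_lower_set => // u rho urho.
  rewrite le_eqVlt => /predU1P[srho|srho].
    have [Mu|uM] := leqP M u; last by right.
    by left; exact: eventually_constant_defect urho Mu.
  left; apply: wt urho _; rewrite leNgt; apply/negP => /smax.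
  by rewrite leNgt srho.
- have [L eL] := sum_e_bounded M c.
  apply/bounded_setP; exists (`|w| + L) => _ [n /= Mn <-].
  by apply: (le_trans (ler_normD _ _)); rewrite lerD2l eL.
- apply: weak_star_closureI => l r r0.
  have [n0 n0P] := sum_e_null M c l r0.
  exists (w + \sum_(u < M) c u *: e u (maxn M n0)).
    by exists (maxn M n0) => //=; exact: leq_maxl.
  move=> z zl; rewrite dualDE addrAC subrr add0r.
  by apply: n0P => //; exact: leq_maxr.
Qed.

(** Only finitely many vertices carry a defect, all of rank less than [t]; the limit [t] leaves room
    for an [s < t] above all these ranks. *)
Lemma lower_ball_limit t : is_limit t ->
  lower_ball t `<=` \bigcup_(s in [set s | (s < t)%O]) lower_ball s.
Proof.
move=> tl g [w [v [-> [N wN wt] v1]]].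
have [s st sP] : exists2 s, (s < t)%O & forall u rho, (u < tree_child N N)%N ->
    ranked u rho -> (s <= rho)%O -> defect N u w = 0.
  elim: (tree_child N N) => [|M [s st sP]].
    by have [s st] := nzero_lt tl.1; exists s.
  have [[rho [Mrho rhot]]|nrho] := pselect (exists rho, ranked M rho /\ (rho < t)%O).
    have maxt : (Order.max s rho < t)%O by rewrite gt_max st.
    have [s' maxs' s't] := limit_dense tl maxt; exists s' => // u rho'.
    move: maxs'; rewrite gt_max => /andP[ss' rhos'].
    rewrite ltnS leq_eqVlt => /predU1P[->|uM] urho' s'rho'.
      by move: rhos'; rewrite (ranked_uniq Mrho urho') ltNge s'rho'.
    by apply: sP uM urho' _; exact: le_trans (ltW ss') s'rho'.
  exists s => // u rho; rewrite ltnS leq_eqVlt => /predU1P[->|uM] urho srho.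
    apply: (wt _ _ urho); rewrite leNgt; apply/negP => rhot; apply: nrho.
    by exists rho.
  exact: sP uM urho srho.
exists s => //; exists w, v; split=> //; exists N => // u rho urho srho.
have [Nu|uN] := leqP (tree_child N N) u; first exact: eventually_constant_defect urho Nu.
exact: sP uN urho srho.
Qed.

(** The functionals [C *: f j] approximate [g] weak*, and among the constraints of rank [alpha] only
    the one at the root can fail; a multiple of some [e 0 n] repairs it. *)
Lemma envelope_lower_ball_top : envelope (lower_ball alpha) = [set: dual X].
Proof.
apply/seteqP; split=> // g _.
have C0 : 0 < `|g| + 1 by rewrite ltr_wpDl.
pose C : K := `|g| + 1; pose w j := C *: f j.
have wN j : eventually_constant j.+1 (w j).
  by apply: eventually_constantZ; exact: eventually_constant_f.
(* [f j] is constant on every sequence from [j.+1] on; the successor of [i.2] meets the requirement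
   [M <= n] with [M = 1]. *)
pose B := [set w i.1 + \sum_(u < 1) correction alpha i.1.+1 (w i.1) u *: e u i.2.+1
  | i in [set: nat * nat]].
rewrite -[g]addr0; apply: (@envelope_lower_ball alpha B); last by rewrite normr0.
- move=> _ [[j n] _ <-] /=; apply: corrected_lower_set => // t rho trho arho.
  right; split; last by rewrite (ranked_top trho arho).
  by apply/le_anti; rewrite arho (ranked_le trho).
- have [L eL] := ws_bounded yef 0%N.
  apply/bounded_setP; exists (C + C * L) => _ [[j n] _ <-] /=.
  have wC : `|w j| <= C.
    by rewrite normrZ (gtr0_norm C0); apply: ler_piMr; [exact: ltW|exact: ws_ball yef _].
  apply: (le_trans (ler_normD _ _)); apply: lerD => //.
  rewrite big_ord_recr big_ord0 /= add0r normrZ.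
  apply: ler_pM; [exact: normr_ge0|exact: normr_ge0| |exact: eL].
  rewrite /correction; case: pselect => ?; last by rewrite normr0 ltW.
  rewrite /defect /x eqxx dual_eval0 sub0r normrN.
  apply: (le_trans (ler_dual_eval _ _)); apply: le_trans wC.
  by apply: ler_piMr; [exact: normr_ge0|exact: (ws_norm yef 0)].
- apply: weak_star_closureI => l r r0.
  have r20 : 0 < r / 2 by rewrite divr_gt0.
  have g1 : `|C^-1 *: g| <= 1.
    rewrite normrZ gtr0_norm ?invr_gt0// mulrC ler_pdivrMr// mul1r.
    by rewrite lerDl ler01.
  have [j jP] := ws_dense yef l g1 (divr_gt0 r20 C0).
  have [n nP] := sum_e_null 1 (correction alpha j.+1 (w j)) l r20.
  exists (w j + \sum_(u < 1) correction alpha j.+1 (w j) u *: e u n.+1).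
    by exists (j, n).
  move=> z zl; rewrite dualDE addrAC [r]splitr.
  apply: (le_lt_trans (ler_normD _ _)); apply: ltrD; last by apply: nP => //; exact: leqnSn.
  have -> : w j z - g z = - (C * ((C^-1 *: g) z - f j z)).
    change (C * f j z - g z = - (C * (C^-1 * g z - f j z))).
    by rewrite mulrBr mulrA mulfV ?mul1r ?opprB// gt_eqF.
  rewrite normrN normrM (gtr0_norm C0) mulrC -ltr_pdivlMr//.
  exact: jP.
Qed.

(** * Properties of the starting set and of its iterates *)

Lemma open_start_set : open start_set.
Proof.
apply: open_ballP => g [a [b [-> sa b1]]].
exists (1 - `|b|); first by rewrite subr_gt0.
move=> h abh; exists a, (h - a); split=> //; first by rewrite addrC subrK.
have -> : h - a = b - (a + b - h) by rewrite opprB addrCA opprD [b + _]addrCA subrr addr0.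
by apply: (le_lt_trans (ler_normB _ _)); rewrite -ltrBrDl.
Qed.

Lemma absolutely_convex_start_set : absolutely_convex start_set.
Proof.
move=> c d' g h cd [a1 [b1 [-> a1s b1n]]] [a2 [b2 [-> a2s b2n]]].
exists (c *: a1 + d' *: a2), (c *: b1 + d' *: b2); split.
- by rewrite !scalerDr addrACA.
- move=> t rho trho; apply: balanced_linear; first exact: a1s trho.
  rewrite -[_ *: a2]addr0; apply: balanced_linear; first exact: a2s trho.
  exact: balanced0.
- apply: (le_lt_trans (ler_normD _ _)); rewrite !normrZ.
  have [->|c0] := eqVneq c 0.
    rewrite normr0 mul0r add0r; apply: le_lt_trans b2n.
    apply: ler_piMl; first exact: normr_ge0.
    by apply: le_trans cd; rewrite lerDr normr_ge0.
  apply: lt_le_trans cd; apply: ltr_leD.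
    by rewrite -[ltRHS]mulr1 ltr_pM2l ?normr_gt0.
  by rewrite -[leRHS]mulr1; apply: ler_wpM2l; [exact: normr_ge0|exact: ltW].
Qed.

(** The root constraint makes [a (y 0 m)] tend to 0, whereas twice [e 0 0] is 2 at [y 0 m] for
    [m > 0] and the perturbation contributes at most [|y 0 m| <= 1]. *)
Lemma e0_notin_upper_set (b : T) : (b <= alpha)%O -> ~ upper_set b (2%:R *: e 0%N 0%N).
Proof.
move=> balpha [a [v [eav ab v1]]].
have [m /(_ m.+1 (leqnSn _))] := ab 0%N alpha ranked_root balpha 1 ltr01.
have ev : 2%:R * e 0%N 0%N (y 0%N m.+1) = a (y 0%N m.+1) + v (y 0%N m.+1).
  by have := congr1 (fun g : dual X => g (y 0%N m.+1)) eav.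
rewrite /x eqxx dual_eval0 sub0r normrN.
have vy : `|v (y 0%N m.+1)| <= 1.
  apply: (le_trans (ler_dual_eval _ _)); apply: mulr_ile1 => //.
  exact: (ws_norm yef 0).
rewrite (ws_eval yef)// mulr1 in ev.
move=> a1; have : `|a (y 0%N m.+1) + v (y 0%N m.+1)| < 1 + 1.
  by apply: (le_lt_trans (ler_normD _ _)); apply: ltr_leD.
by rewrite -ev normr_nat -natr1 ltxx.
Qed.

Hypothesis wfT : well_founded (fun s t : T => (s < t)%O).
Local Notation iter := (iter_envelope wfT start_set).

Lemma iter_start_set_upper t : iter t `<=` upper_set t.
Proof.
apply: iter_envelope_sub.
- move=> s s0 g [a [b [-> sa b1]]]; exists a, b; split=> //; last exact: ltW.
  by move=> u rho urho _; exact: sa urho.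
- exact: envelope_upper_set.
- move=> r s rs g [a [b [-> sa b1]]]; exists a, b; split=> // u rho urho srho.
  by apply: (sa _ _ urho); exact: le_trans (ltW rs) srho.
Qed.

Lemma lower_ball_iter_start_set t : lower_ball t `<=` iter t.
Proof.
apply: sub_iter_envelope.
- move=> s s0 g [w [v [-> [N [wN _] ws] v1]]]; exists w, v; split=> // u rho urho r r0.
  exists N => m Nm; rewrite (wN u m N)//.
  by have := ws _ _ urho (s0 rho); rewrite /defect => ->; rewrite normr0.
- exact: lower_ball_succ.
- exact: lower_ball_limit.
Qed.

Lemma envelope_iter_start_set_top : envelope (iter alpha) = [set: dual X].
Proof.
apply/seteqP; split=> // g _.
have : envelope (lower_ball alpha) g by rewrite envelope_lower_ball_top.
by apply: envelopeS; exact: lower_ball_iter_start_set.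
Qed.

(** A stable iterate [b] would contain every iterate, in particular number [alpha], whose envelope
    is the whole dual; so it would itself be the whole dual, contradicting [e0_notin_upper_set]. *)
Lemma iter_start_set_strict (b : T) : (b <= alpha)%O ->
  iter b `<` envelope (iter b).
Proof.
move=> balpha; split.
  by apply: sub_envelope; apply: open_iter_envelope; exact: open_start_set.
move=> stab; apply: (e0_notin_upper_set balpha); apply: iter_start_set_upper.
apply: (stab); have : [set: dual X] (2%:R *: e 0%N 0%N) by [].
rewrite -envelope_iter_start_set_top; apply: envelopeS.
exact: iter_envelope_stable open_start_set stab _.
Qed.

(** Closed balls absorb their envelopes, so from a bounded start the envelope of iterate [alpha]
    would be bounded, although it is the whole dual, which contains the nonzero [e 0 0]. *)
Lemma unbounded_start_set : ~ bounded_set start_set.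
Proof.
move=> /bounded_setP[C UC].
have iterC t : iter t `<=` [set g | `|g| <= C].
  apply: (@iter_envelope_sub _ _ _ _ _ wfT _ (fun=> [set g | `|g| <= C])).
  - by move=> ? _; exact: UC.
  - by move=> ? ? _ g [B [BC _ _]]; exact: weak_star_closure_ball.
  - by move=> ? ? _ g.
have allC g : `|g| <= C.
  have : envelope (iter alpha) g by rewrite envelope_iter_start_set_top.
  by move=> [B [BU _ _]]; apply: weak_star_closure_ball => h /BU/iterC.
have C0 : 0 <= C := le_trans (normr_ge0 0) (allC 0).
have := allC ((C + 1) *: e 0%N 0%N).
rewrite normrZ ger0_norm ?addr_ge0// => /(le_trans _) le1.
have : (C + 1) * 1 <= C.
  apply: le1; apply: ler_wpM2l; first by rewrite addr_ge0.
  rewrite -[leLHS](normr1 K) -[X in `|X|](_ : e 0%N 0%N (y 0%N 1%N) = 1).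
    apply: (le_trans (ler_dual_eval _ _)); apply: ler_piMr => //.
    exact: (ws_norm yef 0).
  by rewrite (ws_eval yef).
by rewrite mulr1 gerDl (lt_geF ltr01).
Qed.

End constraints.
End tree.

Theorem theorem4p2 (R : realType) (cplx : bool)
  (X : completeNormedModType (scalars R cplx))
  (sepX : separable X) (nqrX : ~ quasireflexive X)
  (d : Order.disp_t) (T : orderType d)
  (wfT : well_founded (fun s t : T => (s < t)%O))
  (alpha : T) (alpha_lt_omega1 : countable [set s : T | (s < alpha)%O]) :
  exists U : set (dual X),
    [/\ ~ bounded_set U, absolutely_convex U, open U,
        (forall beta : T, (beta <= alpha)%O ->
          iter_envelope wfT U beta `<` envelope (iter_envelope wfT U beta)) &
        envelope (iter_envelope wfT U alpha) = [set: dual X]].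
Proof.
have [y [e [f yef]]] := exists_weak_system sepX nqrX.
have /choice[child childP] : forall rho : T, exists c : nat -> option T,
    (forall k sigma, c k = Some sigma -> (sigma < rho)%O) /\
    ((rho <= alpha)%O -> forall b, (b < rho)%O -> exists k0, forall k, (k0 <= k)%N ->
      exists2 sigma, c k = Some sigma & (b <= sigma)%O).
  move=> rho; have [rhoalpha|nrho] := leP rho alpha; last first.
    (* Elements above [alpha] are not ranks of vertices, and countability is known only up to
       [alpha]. *)
    by exists (fun=> None).
  have [|c [c1 c2]] := @countable_cofinal _ T rho.
    by apply: sub_countable alpha_lt_omega1; apply: subset_card_le => s /= /lt_le_trans; apply.
  by exists c; split=> // _.
have child_lt rho k sigma := (childP rho).1 k sigma.
have child_cofinal rho b rhoalpha := (childP rho).2 rhoalpha b.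
exists (start_set alpha child y); split.
- exact: (unbounded_start_set child_lt yef wfT).
- exact: absolutely_convex_start_set.
- exact: open_start_set.
- move=> b; exact: (iter_start_set_strict child_lt child_cofinal yef wfT).
- exact: (envelope_iter_start_set_top alpha child_lt yef wfT).
Qed.
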